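(* Let $(Y_n)_{n\in\mathbb Z}$ be a strongly stationary, $\alpha$-mixing $\mathcal Y$-valued process and $Q$ a parametric kernel such that Assumption (A) of the context holds. Let $((X_n^*,Y_n))_{n\in\mathbb Z}$ be the stationary process (unique in law) such that $(X_n^* )_{n\in\mathbb Z}$ is a Markov chain in the random environment $(Y_n)_{n\in\mathbb Z}$ with kernel $Q$. Set $r_i=\sum_{\ell\ge i}d_\ell$ for $i\ge1$. Then there exist $\kappa\in(0,1)$ and $c>0$ such that for all $n\ge1$ $$\alpha^{X^*,Y}(n)\le c\inf_{1\le i\le q\le n}\left\{r_i+\kappa^{n/q}+\alpha^Y(q-i)\right\},$$ where $i,q$ range over integers.
   Context: $\mathcal X,\mathcal Y$ are complete separable metric spaces with Borel $\sigma$-algebras. A parametric kernel is a map $Q:\mathcal Y\times\mathcal X\times\mathcal B(\mathcal X)\to[0,1]$ such that $Q(y,x,\cdot)$ is a probability measure for each $(y,x)$ and $(x,y)\mapsto Q(y,x,B)$ is measurable for each $B$. For measurable $\phi\ge0$, $[Q(y)\phi](x)=\int\phi(z)Q(y,x,dz)$. For $I=\mathbb N$ or $\mathbb Z$, $(X_n)_{n\in I}$ is a Markov chain in the random environment $(Y_n)_{n\in I}$ with kernel $Q$ if $\mathbb P(X_{n+1}\in B\mid (X_k)_{k\le n},(Y_k)_{k\in I})=Q(Y_n,X_n,B)$ for all $B\in\mathcal B(\mathcal X)$, $n\in I$. Under Assumption (A) and stationarity of $(Y_n)_{n\in\mathbb Z}$ it is known that a process $(X_n^* )_{n\in\mathbb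 Z}$ exists which is a Markov chain in the random environment $(Y_n)$ with kernel $Q$ and such that $((X_n^*,Y_n))_{n\in\mathbb Z}$ is stationary, and that the law of the latter is unique. Mixing: for sub-$\sigma$-algebras, $\alpha(\mathcal G,\mathcal H)=\sup\{|\mathbb P(G\cap H)-\mathbb P(G)\mathbb P(H)|:G\in\mathcal G,H\in\mathcal H\}$. For a process $W=(W_t)_{t\in I}$, $\mathcal F^W_{t,s}=\sigma(W_k:k\in I,t\le k\le s)$ (trivial if the index set is empty) and $\alpha^W(n)=\sup_{j\in\mathbb Z}\alpha(\mathcal F^W_{-\infty,j},\mathcal F^W_{j+n,\infty})$, $n\ge0$. $W$ is $\alpha$-mixing if $\alpha^W(n)\to0$. $\alpha^{X^*,Y}$ denotes the coefficients of $((X^*_n,Y_n))_n$. Assumption (A): (drift) there are measurable $V:\mathcal X\to[0,\infty)$ and $\gamma,K:\mathcal Y\to(0,\infty)$ with $[Q(y)V](x)\le\gamma(y)V(x)+K(y)$ for all $(y,x)$; (minorization) for every $R>0$ there is a probability kernel $\kappa_R:\mathcal Y\times\mathcal B(\mathcal X)\to[0,1]$, and there is a measurable $\beta:[0,\infty)\times\mathcal Y\to[0,1)$, with $Q(y,x,A)\ge(1-\beta(R,y))\kappa_R(y,A)$ for all $y\in\mathcal Y$, $x$ with $V(x)\le R$, $A\in\mathcal B(\mathcal X)$; (A1) $r_0:=\sum_{\ell\ge0}d_\ell<\infty$, where $d_0=\sup_{t\ge0}\mathbb E[K(Y_t)+\gamma(Y_t)]<\infty$ and $d_\ell=\sup_{t\ge-1}\mathbb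 E\big[K(Y_t)\prod_{i=1}^\ell\gamma(Y_{t+i})\big]$ for $\ell\ge1$, with the convention that $K(Y_{-1})$ is replaced by $1$ in the term $t=-1$; (A2) for every $R>0$, $\lim_{\bar\beta\uparrow1}\sup_{t\in\mathbb N}\mathbb P(\beta(R,Y_t)>\bar\beta)=0$. *)

(* Defs.v *)
From HB Require Import structures.
From mathcomp Require Import all_boot all_order all_algebra.
From mathcomp Require Import all_classical all_reals all_analysis.
From mathcomp Require Import measurable_realfun.

Set Implicit Arguments.
Unset Strict Implicit.
Unset Printing Implicit Defensive.

Import Order.TTheory GRing.Theory Num.Theory.
Import numFieldTopology.Exports numFieldNormedType.Exports.

Local Open Scope classical_set_scope.
Local Open Scope ring_scope.

#[short(type="completeMetricType")]
HB.structure Definition CompleteMetric (R : numDomainType) :=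
  {T of Complete T & Metric R T}.

Definition separable (T : topologicalType) : Prop :=
  exists2 D : set T, countable D & dense D.

Notation borel T := (g_sigma_algebraType (@open T)).

Section stochastic_processes.
Context {d : measure_display} {Omega : measurableType d} {R : realType}.
Variable P : probability Omega R.
Local Open Scope ereal_scope.

(* f is a version of the conditional probability P(A | G) *)
Definition is_cond_prob (G : set (set Omega)) (A : set Omega)
    (f : Omega -> \bar R) : Prop :=
  (forall B : set (\bar R), measurable B -> G (f @^-1` B)) /\
  (forall H, G H -> \int[P]_(w in H) f w = P (A `&` H)).

(* the coefficient alpha(G, H) of two sub-sigma-algebras *)
Definition alpha_dep (G H : set (set Omega)) : \bar R :=
  ereal_sup [set `|P (A `&` B) - P A * P B| | A in G & B in H].

Section one_process.
Context {d' : measure_display} {T : measurableType d'}.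
Implicit Type W : int -> {RV P >-> T}.

Definition events (J : set int) W : set (set Omega) :=
  \bigcup_(k in J) g_sigma_algebra_preimage (W k).

Definition sigma_process (J : set int) W : set (set Omega) :=
  <<s events J W >>.

Definition alpha_coef W (n : nat) : \bar R :=
  ereal_sup [set alpha_dep (sigma_process [set k : int | (k <= j)%R] W)
                           (sigma_process [set k : int | (j + n%:Z <= k)%R] W)
            | j in [set: int]].

Definition alpha_mixing W : Prop := alpha_coef W n @[n --> \oo] --> 0.

(* all finite-dimensional laws, on the product space T^m, are invariant under
   every time shift *)
Definition stationary W : Prop :=
  forall (m : nat) (t : 'I_m -> int) (h : int) (A : set (m.-tuple T)),
    measurable A ->
    pushforward P (fun w => [tuple W (t i + h)%R w | i < m]) A =
    pushforward P (fun w => [tuple W (t i) w | i < m]) A.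

End one_process.

Section joint_process.
Context {d1 d2 : measure_display}.
Context {T1 : measurableType d1} {T2 : measurableType d2}.
Variables (X : int -> {RV P >-> T1}) (Y : int -> {RV P >-> T2}).

Definition joint_fun (n : int) (w : Omega) : (T1 * T2)%type := (X n w, Y n w).

Lemma measurable_joint n : measurable_fun [set: Omega] (joint_fun n).
Proof. by apply: measurable_fun_pair; exact: measurable_funPT. Qed.

HB.instance Definition _ n :=
  isMeasurableFun.Build _ _ _ _ (joint_fun n) (measurable_joint n).

Definition joint (n : int) : {RV P >-> (T1 * T2)%type} := joint_fun n.

End joint_process.

Section random_environment.
Context {dX dY : measure_display}.
Context {TX : measurableType dX} {TY : measurableType dY}.
Variable Q : R.-pker (TY * TX)%type ~> TX.

(* [Q(y) phi](x) *)
Definition kernel_act (y : TY) (phi : TX -> \bar R) (x : TX) : \bar R :=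
  \int[Q (y, x)]_z phi z.

(* X is a Markov chain in the random environment Y, with time index set Z *)
Definition MCRE (X : int -> {RV P >-> TX}) (Y : int -> {RV P >-> TY}) : Prop :=
  forall (n : int) (B : set TX), measurable B ->
    is_cond_prob <<s events [set k : int | (k <= n)%R] X `|` events setT Y >>
      (X (n + 1)%R @^-1` B)
      (fun w => Q (Y n w, X n w) B).

(* K(Y_t), with the convention that K(Y_{-1}) is replaced by 1 *)
Definition K_env (K : TY -> R) (Y : int -> {RV P >-> TY}) (t : int)
    (w : Omega) : R :=
  if t == (-1)%R then 1%R else K (Y t w).

Definition d_coef (gamma K : TY -> R) (Y : int -> {RV P >-> TY}) (l : nat)
    : \bar R :=
  if l is 0%N then
    ereal_sup [set 'E_P[fun w => (K (Y t w) + gamma (Y t w))%R]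
              | t in [set t : int | (0 <= t)%R]]
  else
    ereal_sup [set 'E_P[fun w => (K_env K Y t w *
                          \prod_(1 <= i < l.+1) gamma (Y (t + i%:Z) w))%R]
              | t in [set t : int | (-1 <= t)%R]].

Definition r_coef (gamma K : TY -> R) (Y : int -> {RV P >-> TY}) (i : nat)
    : \bar R :=
  \sum_(i <= l <oo) d_coef gamma K Y l.

Definition drift (V : TX -> R) (gamma K : TY -> R) : Prop :=
  [/\ measurable_fun [set: TX] V /\ (forall x, 0 <= V x)%R,
      measurable_fun [set: TY] gamma /\ (forall y, 0 < gamma y)%R,
      measurable_fun [set: TY] K /\ (forall y, 0 < K y)%R &
      forall y x, kernel_act y (EFin \o V) x <= (gamma y * V x + K y)%:E].

(* beta only matters on [0, +oo[ * TY *)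
Definition minorization (V : TX -> R) (beta : R -> TY -> R) : Prop :=
  [/\ measurable_fun [set p : R * TY | (0 <= p.1)%R] (fun p => beta p.1 p.2),
      forall r y, (0 <= r)%R -> (0 <= beta r y < 1)%R &
      forall r : R, (0 < r)%R -> exists kappa : R.-pker TY ~> TX,
        forall y x A, (V x <= r)%R -> measurable A ->
          (1 - beta r y)%:E * kappa y A <= Q (y, x) A].

Definition summability (gamma K : TY -> R) (Y : int -> {RV P >-> TY}) : Prop :=
  d_coef gamma K Y 0 < +oo /\ r_coef gamma K Y 0 < +oo.

Definition small_set_tail (beta : R -> TY -> R) (Y : int -> {RV P >-> TY})
    : Prop :=
  forall r : R, (0 < r)%R ->
    ereal_sup [set P [set w | (b < beta r (Y t%:Z w))%R] | t in [set: nat]]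
      @[b --> (1%R : R)^'-] --> 0.

Record assumptionA (V : TX -> R) (gamma K : TY -> R) (beta : R -> TY -> R)
    (Y : int -> {RV P >-> TY}) : Prop := AssumptionA {
  A_drift : drift V gamma K;
  A_minorization : minorization V beta;
  A1 : summability gamma K Y;
  A2 : small_set_tail beta Y
}.

End random_environment.
End stochastic_processes.

(* Main.v *)
(* Averages under the kernel along a fixed environment y forget their starting
   state: with attempts at the last step of blocks of length q + 1, two starting
   states x, x' are indistinguishable after k blocks up to S_k, where
   S_(k+1) = min(1, rho_k S_k + D_k).  Here rho_k < 1 when the part of the drift
   bound produced by the i steps before the attempt is small (minorization), and
   D_k is the remaining part of the drift bound.  For the stationary environment,
   rho_k and S_k depend on values of Y separated by a gap q - i, so that
   E S_(k+1) <= p E S_k + alpha^Y(q - i) + C r_i: the errors of a block are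
   contracted by the next ones.

   S_k depends on the initial state only through V, hence forgetting from the
   remote past (V(X_n) is tight) shows that the past of X is a function of the
   past of Y up to small errors; therefore the past of (X, Y) and the future of Y
   have the mixing coefficients of Y.

   For A in the past of j and B in the future of j + n, the conditional
   probability of B given X_s and Y, s = j + (q - i), is up to S_k the one with
   X_s replaced by a fixed state, a function of Y after time s, which is nearly
   independent of A. *)
Require Import Defs.
From HB Require Import structures.
From mathcomp Require Import all_boot all_order all_algebra.
From mathcomp Require Import all_classical all_reals all_analysis.
From mathcomp Require Import measurable_realfun ring lra zify.

Set Implicit Arguments.
Unset Strict Implicit.
Unset Printing Implicit Defensive.

Import Order.TTheory GRing.Theory Num.Theory.
Import numFieldTopology.Exports numFieldNormedType.Exports.

Local Open Scope classical_set_scope.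
Local Open Scope ring_scope.

(** * Bounded measurable functions *)

(** No coupled process is built: [Omega] and [X] are given and need not leave room for extra
    randomness, so coupling is replaced by oscillation bounds for averages of [0,1]-valued
    functions. Three obstacles shape the rest. [V (X s)] is not known to be integrable, so errors
    are truncated at 1 and stationarity supplies tightness in place of moments. Estimating
    [uncoupled] from the start [V (X s)] requires covariances between the past of (X, Y) and the
    future of Y, whose bound itself requires forgetting; two passes break this circle: a constant
    start, for which the mixing of Y alone is enough, then [V (X s)]. Finally, conditional
    probabilities are only approximated by functions of the relevant variables, up to any error:
    this property passes from cylinders to all events by Dynkin's argument. Dependence on a part of
    the processes is expressed by measurability on [g_sigma_algebraType (history X Y J I)], which
    has the points of [Omega] and fewer events. *)

Lemma indic01 {T : Type} {R : numDomainType} (A : set T) x : 0 <= (\1_A x : R) <= 1.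
Proof. by rewrite indicE; case: (_ \in _); rewrite /= ?lexx ?ler01. Qed.

Section bounded_functions.
Context {d : measure_display} {T : measurableType d} {R : realType}.
Implicit Types f g : T -> R.

Definition bounded_mfun f :=
  measurable_fun setT f /\ exists M, forall x, `|f x| <= M.

Definition unit_mfun f := measurable_fun setT f /\ forall x, 0 <= f x <= 1.

Lemma unit_bounded_mfun f : unit_mfun f -> bounded_mfun f.
Proof.
move=> [mf f01]; split => //; exists 1 => x.
by have /andP[f0 f1] := f01 x; rewrite ger0_norm.
Qed.

Lemma bounded_mfun_cst (c : R) : bounded_mfun (fun=> c).
Proof. by split; [exact: measurable_cst|exists `|c|]. Qed.

Lemma bounded_mfunD f g :
  bounded_mfun f -> bounded_mfun g -> bounded_mfun (fun x => f x + g x).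
Proof.
move=> [mf [M fM]] [mg [N gN]]; split; first exact: measurable_funD.
by exists (M + N) => x; rewrite (le_trans (ler_normD _ _))// lerD.
Qed.

Lemma bounded_mfunM f g :
  bounded_mfun f -> bounded_mfun g -> bounded_mfun (fun x => f x * g x).
Proof.
move=> [mf [M fM]] [mg [N gN]]; split; first exact: measurable_funM.
by exists (M * N) => x; rewrite normrM ler_pM.
Qed.

Lemma bounded_mfunZ (c : R) f : bounded_mfun f -> bounded_mfun (fun x => c * f x).
Proof. exact/bounded_mfunM/bounded_mfun_cst. Qed.

Lemma bounded_mfunN f : bounded_mfun f -> bounded_mfun (fun x => - f x).
Proof.
by move=> [mf [M fM]]; split; [exact: measurable_funN|exists M => x; rewrite normrN].
Qed.

Lemma bounded_mfunB f g :
  bounded_mfun f -> bounded_mfun g -> bounded_mfun (fun x => f x - g x).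
Proof. by move=> bf /bounded_mfunN; exact: bounded_mfunD. Qed.

Lemma bounded_mfun_norm f : bounded_mfun f -> bounded_mfun (fun x => `|f x|).
Proof.
move=> [mf [M fM]]; split; first by apply: measurableT_comp.
by exists M => x; rewrite normr_id.
Qed.

Lemma bounded_mfun_sum (I : Type) (s : seq I) (F : I -> T -> R) :
  (forall i, bounded_mfun (F i)) -> bounded_mfun (fun x => \sum_(i <- s) F i x).
Proof.
move=> bF; elim: s => [|i s IH].
  by under eq_fun do rewrite big_nil; exact: bounded_mfun_cst.
by under eq_fun do rewrite big_cons; exact: bounded_mfunD.
Qed.

Lemma unit_mfun_indic (A : set T) : measurable A -> unit_mfun (\1_A : T -> R).
Proof.
by move=> mA; split; [exact: measurable_indic|move=> x; exact: indic01].
Qed.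

Lemma unit_mfun_cst (c : R) : 0 <= c <= 1 -> unit_mfun (fun=> c).
Proof. by split. Qed.

Lemma unit_mfunM f g : unit_mfun f -> unit_mfun g -> unit_mfun (fun x => f x * g x).
Proof.
move=> [mf f01] [mg g01]; split; first exact: measurable_funM.
move=> x; have /andP[f0 f1] := f01 x; have /andP[g0 g1] := g01 x.
by rewrite mulr_ge0//= mulr_ile1.
Qed.

Lemma unit_mfun_compl f : unit_mfun f -> unit_mfun (fun x => 1 - f x).
Proof.
move=> [mf f01]; split; first exact: measurable_funB.
by move=> x; have := f01 x; lra.
Qed.

Lemma unit_mfun_min1 f : measurable_fun setT f -> (forall x, 0 <= f x) ->
  unit_mfun (fun x => Num.min 1 (f x)).
Proof.
move=> mf f0; split; first exact: measurable_minr.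
by move=> x; rewrite le_min ler01 f0 ge_min lexx.
Qed.

End bounded_functions.

Section composition.
Context {d d' : measure_display} {T : measurableType d} {T' : measurableType d'}
  {R : realType}.
Variable phi : T -> T'.
Hypothesis mphi : measurable_fun setT phi.

Lemma unit_mfun_comp (f : T' -> R) : unit_mfun f -> unit_mfun (f \o phi).
Proof. by move=> [mf f01]; split; [exact: measurableT_comp|move=> x; exact: f01]. Qed.

Lemma bounded_mfun_comp (f : T' -> R) : bounded_mfun f -> bounded_mfun (f \o phi).
Proof.
by move=> [mf [M fM]]; split; [exact: measurableT_comp|exists M => x; exact: fM].
Qed.

End composition.

Section expectation.
Context {d : measure_display} {T : measurableType d} {R : realType}.
Variable mu : {measure set T -> \bar R}.
Hypothesis mu1 : mu setT = 1%E.
Implicit Types f g : T -> R.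

Lemma bounded_integrable f : bounded_mfun f -> mu.-integrable setT (EFin \o f).
Proof.
move=> [mf [M fM]]; apply: measurable_bounded_integrable => //.
  by rewrite mu1 ltry.
exists M; split; first exact: num_real.
by move=> N MN x _ /=; rewrite (le_trans (fM x))// ltW.
Qed.

Lemma Rintegral_EFin f : bounded_mfun f ->
  (\int[mu]_x f x)%:E = (\int[mu]_x (f x)%:E)%E.
Proof. by move=> bf; rewrite /Rintegral fineK//; apply: integrable_fin_num => //; exact: bounded_integrable. Qed.

Lemma ExpD f g : bounded_mfun f -> bounded_mfun g ->
  \int[mu]_x (f x + g x) = \int[mu]_x f x + \int[mu]_x g x.
Proof. by move=> bf bg; apply: RintegralD => //; exact: bounded_integrable. Qed.

Lemma ExpB f g : bounded_mfun f -> bounded_mfun g ->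
  \int[mu]_x (f x - g x) = \int[mu]_x f x - \int[mu]_x g x.
Proof. by move=> bf bg; apply: RintegralB => //; exact: bounded_integrable. Qed.

Lemma ExpZ (c : R) f : bounded_mfun f ->
  \int[mu]_x (c * f x) = c * \int[mu]_x f x.
Proof. by move=> bf; apply: RintegralZl => //; exact: bounded_integrable. Qed.

Lemma Exp_cst (c : R) : \int[mu]_(x in setT) c = c.
Proof. by rewrite Rintegral_cst// mu1 mulr1. Qed.

Lemma le_Exp f g : bounded_mfun f -> bounded_mfun g -> (forall x, f x <= g x) ->
  \int[mu]_x f x <= \int[mu]_x g x.
Proof. by move=> bf bg fg; apply: le_Rintegral => //; exact: bounded_integrable. Qed.

Lemma Exp_ge0 f : (forall x, 0 <= f x) -> 0 <= \int[mu]_x f x.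
Proof. by move=> f0; exact: Rintegral_ge0. Qed.

Lemma Exp_unit f : unit_mfun f -> 0 <= \int[mu]_x f x <= 1.
Proof.
move=> uf; have [mf f01] := uf; apply/andP; split.
  by apply: Exp_ge0 => x; case/andP: (f01 x).
rewrite -[leRHS]Exp_cst; apply: le_Exp; [exact: unit_bounded_mfun|exact: bounded_mfun_cst|].
by move=> x; case/andP: (f01 x).
Qed.

Lemma norm_Exp_le f (M : R) : bounded_mfun f -> (forall x, `|f x| <= M) ->
  `|\int[mu]_x f x| <= M.
Proof.
move=> bf fM; rewrite ler_norml; apply/andP; split.
  rewrite -[leLHS]Exp_cst; apply: le_Exp => //; first exact: bounded_mfun_cst.
  by move=> x; have := fM x; rewrite ler_norml => /andP[].
rewrite -[leRHS]Exp_cst; apply: le_Exp => //; first exact: bounded_mfun_cst.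
by move=> x; have := fM x; rewrite ler_norml => /andP[].
Qed.

Lemma Exp_sum (I : Type) (s : seq I) (F : I -> T -> R) :
  (forall i, bounded_mfun (F i)) ->
  \int[mu]_x (\sum_(i <- s) F i x) = \sum_(i <- s) \int[mu]_x F i x.
Proof.
move=> bF; elim: s => [|i s IH].
  by under eq_Rintegral do rewrite big_nil; rewrite Exp_cst big_nil.
under eq_Rintegral do rewrite big_cons.
by rewrite ExpD ?big_cons ?IH//; exact: bounded_mfun_sum.
Qed.

Lemma Exp_indic (A : set T) : measurable A -> \int[mu]_x (\1_A x) = fine (mu A).
Proof. by move=> mA; rewrite /Rintegral integral_indic// setIT. Qed.

Lemma Exp_min1_le (f : T -> R) (C : \bar R) : measurable_fun setT f ->
  (forall x, 0 <= f x) -> (\int[mu]_x (f x)%:E <= C)%E ->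
  ((\int[mu]_x Num.min 1 (f x))%R%:E <= C)%E.
Proof.
move=> mf f0 fC; have um := unit_mfun_min1 mf f0.
rewrite Rintegral_EFin; last exact: unit_bounded_mfun.
apply: le_trans fC; apply: ge0_le_integral => //.
- by move=> x _; rewrite lee_fin; case/andP: (um.2 x).
- by apply/measurable_EFinP; exact: um.1.
- by apply/measurable_EFinP.
- by move=> x _; rewrite lee_fin ge_min lexx orbT.
Qed.

End expectation.

(** * Layers of [0,1]-valued functions; extension of bounds from events to functions *)

Section layers.
Context {d : measure_display} {S : measurableType d} {R : realType}.

(** The sum counts the thresholds (k+1)/n reached by [f x], hence equals the integer part of
    [n * f x]. *)
Lemma unit_mfun_layers (f : S -> R) (n : nat) : unit_mfun f -> (0 < n)%N ->
  forall x, `|f x - n%:R^-1 * \sum_(0 <= k < n)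
     (\1_[set y | k.+1%:R / n%:R <= f y] x)| <= n%:R^-1.
Proof.
move=> [mf f01] n0 x; have /andP[f0 f1] := f01 x.
have n0' : 0 < n%:R :> R by rewrite ltr0n.
pose m := Num.truncn (n%:R * f x).
have nf0 : 0 <= n%:R * f x by rewrite mulr_ge0// ltW.
have /andP[m1 m2] := Num.Theory.truncn_itv nf0.
rewrite -/m in m1 m2.
have mn : (m <= n)%N.
  rewrite -(ler_nat R) (le_trans m1)//; rewrite ler_piMr//; exact: ltW.
have -> : \sum_(0 <= k < n) (\1_[set y | k.+1%:R / n%:R <= f y] x) = m%:R :> R.
  rewrite (big_cat_nat (n := m))//= big_nat_cond (eq_bigr (fun=> 1)); last first.
    move=> k /andP[/andP[_ km] _]; rewrite indicE mem_set//=.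
    rewrite ler_pdivrMr// mulrC (le_trans _ m1)// ler_nat//.
  rewrite -big_nat_cond sumr_const_nat subn0 big_nat_cond big1 ?addr0//.
  move=> k /andP[/andP[mk _] _]; rewrite indicE memNset//=.
  apply/negP; rewrite -ltNge ltr_pdivlMr// mulrC (lt_le_trans m2)// ler_nat//.
rewrite ler_norml; apply/andP; split.
  rewrite lerBrDl -(ler_pM2l n0') mulrDr mulrN !mulrA mulfV ?gt_eqF// !mul1r.
  by lra.
rewrite lerBlDl -(ler_pM2l n0') mulrDr !mulrA mulfV ?gt_eqF// mul1r -natr1 in m2 *.
exact: ltW.
Qed.

Lemma superlevel_measurable (f : S -> R) (c : R) : measurable_fun setT f ->
  measurable [set y | c <= f y].
Proof.
move=> mf; rewrite -[X in measurable X]setTI.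
rewrite (_ : [set y | c <= f y] = f @^-1` `[c, +oo[); first exact: mf.
by apply/seteqP; split => y /=; rewrite in_itv/= andbT.
Qed.

Lemma strict_superlevel_measurable (f : S -> R) (c : R) : measurable_fun setT f ->
  measurable [set y | c < f y].
Proof.
move=> mf; rewrite -[X in measurable X]setTI.
rewrite (_ : [set y | c < f y] = f @^-1` `]c, +oo[); first exact: mf.
by apply/seteqP; split => y /=; rewrite in_itv/= andbT.
Qed.

(** A unit function is uniformly close to an average of indicators with equal weights of total mass
    1, so the bound [a] on events survives without any factor; [C] only controls the vanishing
    uniform error. With [a = 0] this extends identities from events to functions. *)
Lemma functional_bound (L : (S -> R) -> R) (C a : R) :
  (forall f g, bounded_mfun f -> bounded_mfun g -> L (fun x => f x + g x) = L f + L g) ->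
  (forall c f, bounded_mfun f -> L (fun x => c * f x) = c * L f) ->
  (forall f M, bounded_mfun f -> (forall x, `|f x| <= M) -> `|L f| <= C * M) ->
  (forall A, measurable A -> `|L (\1_A)| <= a) ->
  forall f, unit_mfun f -> `|L f| <= a.
Proof.
move=> LD LZ LC La f uf; apply/ler_addgt0Pr => e e0.
have C0 : 0 <= C.
  rewrite -(mulr1 C) (le_trans (normr_ge0 (L (fun=> 0))))// LC//.
    exact: bounded_mfun_cst.
  by move=> x; rewrite normr0.
pose n := (Num.truncn (C / e)).+1.
have n0 : 0 < n%:R :> R by rewrite ltr0n.
have nC : C * n%:R^-1 <= e.
  rewrite ler_pdivrMr// mulrC -ler_pdivrMr// ltW//.
  by have /andP[] := Num.Theory.truncn_itv (divr_ge0 C0 (ltW e0)).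
pose I k : S -> R := \1_[set y | k.+1%:R / n%:R <= f y].
have uI k : unit_mfun (I k).
  by apply: unit_mfun_indic; apply: superlevel_measurable; case: uf.
have bI k : bounded_mfun (I k) by exact: unit_bounded_mfun.
have Lsum (s : seq nat) : L (fun x => \sum_(k <- s) I k x) = \sum_(k <- s) L (I k).
  elim: s => [|k s IH].
    rewrite big_nil; under eq_fun do rewrite big_nil -(mul0r 0).
    by rewrite LZ ?mul0r//; exact: bounded_mfun_cst.
  rewrite big_cons -IH -LD//; last exact: bounded_mfun_sum.
  by congr L; apply/funext => x; rewrite big_cons.
pose g x := n%:R^-1 * \sum_(0 <= k < n) I k x.
have bg : bounded_mfun g by apply: bounded_mfunZ; exact: bounded_mfun_sum.
have bf := unit_bounded_mfun uf.
have -> : f = (fun x => (f x - g x) + g x) by apply/funext => x; rewrite subrK.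
rewrite LD//; last exact: bounded_mfunB.
rewrite addrC (le_trans (ler_normD _ _))// lerD//.
  rewrite /g LZ; last exact: bounded_mfun_sum.
  rewrite Lsum normrM ger0_norm ?invr_ge0 ?ler0n// mulrC ler_pdivrMr//.
  rewrite (le_trans (ler_norm_sum _ _ _))//.
  rewrite (_ : a * n%:R = \sum_(0 <= k < n) a); last first.
    by rewrite sumr_const_nat subn0 mulr_natr.
  by apply: ler_sum => k _; apply: La; apply: superlevel_measurable; case: uf.
rewrite (le_trans (LC _ n%:R^-1 _ _))//; first exact: bounded_mfunB.
by move=> x; exact: unit_mfun_layers.
Qed.

End layers.

(** * Averaging under the parametric kernel *)

Section kernel_pullback.
Context {d d' d'' : measure_display} {S : measurableType d} {T : measurableType d'}
  {U : measurableType d''} {R : realType}.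
Variables (Q : R.-pker T ~> U) (g : S -> T) (mg : measurable_fun setT g).

(** Reparametrizing the kernel along [g] reduces joint measurability of averages to that of
    integrals against a kernel on [S]. The measurability proof is an argument so that the kernel
    structure can be attached to the term. *)
Definition kpull of measurable_fun setT g : S -> {measure set U -> \bar R} :=
  fun s => Q (g s).

HB.instance Definition _ := isKernel.Build _ _ S U R (kpull mg)
  (fun A mA => measurableT_comp (measurable_kernel Q A mA) mg).

HB.instance Definition _ := Kernel_isProbability.Build _ _ S U R (kpull mg)
  (fun s => @prob_kernel _ _ _ _ _ Q (g s)).

Definition pkpull : R.-pker S ~> U := kpull mg.

End kernel_pullback.

Section kernel_integral.
Context {d d' : measure_display} {S : measurableType d} {T : measurableType d'}
  {R : realType}.
Variable l : R.-pker S ~> T.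

Lemma pkerT (s : S) : l s setT = 1%E. Proof. exact: prob_kernel. Qed.

Lemma unit_mfun_kernel (f : S * T -> R) : unit_mfun f ->
  unit_mfun (fun s => \int[l s]_t f (s, t)).
Proof.
move=> [mf f01]; split; last first.
  move=> s; apply: Exp_unit; first exact: pkerT.
  by split => [|t]; [exact: measurableT_comp|exact: f01].
apply: (measurableT_comp (fine_measurable _)) => //.
apply: (measurable_fun_integral_finite_kernel (EFin \o f)).
  by move=> z; rewrite lee_fin; case/andP: (f01 z).
exact/measurable_EFinP.
Qed.

Lemma bounded_mfun_kernel (f : S * T -> R) : bounded_mfun f ->
  bounded_mfun (fun s => \int[l s]_t f (s, t)).
Proof.
move=> bf; have [mf [M fM]] := bf.
have bfs s : bounded_mfun (fun t => f (s, t)).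
  by split; [exact: measurableT_comp|exists M => t; exact: fM].
split; last first.
  by exists M => s; apply: norm_Exp_le => //; exact: pkerT.
(* The shift by [M] makes the integrand nonnegative, the case in which measurability in the
   parameter is at hand. *)
rewrite (_ : (fun s => _) = (fun s => \int[l s]_t (f (s, t) + M) - M)); last first.
  apply/funext => s; rewrite (ExpD (pkerT s))//; last exact: bounded_mfun_cst.
  by rewrite Exp_cst ?addrK//; exact: pkerT.
apply: measurable_funB => //.
apply: (measurableT_comp (fine_measurable _)) => //.
apply: (measurable_fun_integral_finite_kernel (fun z => (f z + M)%:E)).
  by move=> z; rewrite lee_fin; have := fM z; rewrite ler_norml => /andP[]; lra.
by apply/measurable_EFinP; apply: measurable_funD.
Qed.

End kernel_integral.

Lemma Exp_minorized {d} {T : measurableType d} {R : realType}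
  (mu nu : {measure set T -> \bar R}) (c : R) :
  mu setT = 1%E -> nu setT = 1%E -> 0 <= c ->
  (forall A, measurable A -> (c%:E * nu A <= mu A)%E) ->
  forall f, unit_mfun f -> c * (\int[nu]_x f x) <= \int[mu]_x f x.
Proof.
move=> mu1 nu1 c0 numu f uf; have bf := unit_bounded_mfun uf; have [mf f01] := uf.
have f0 x : (0 <= (f x)%:E)%E by rewrite lee_fin; case/andP: (f01 x).
rewrite -lee_fin EFinM !Rintegral_EFin// (_ : c = (NngNum c0)%:num)//.
rewrite -ge0_integral_mscale//; last exact/measurable_EFinP.
by apply: ge0_le_measure_integral => //; exact/measurable_EFinP.
Qed.

Section environment_operator.
Context {dX dY : measure_display} {TX : measurableType dX} {TY : measurableType dY}
  {R : realType}.
Variable Q : R.-pker (TY * TX)%type ~> TX.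
Implicit Types (h g : TX -> R) (y : TY) (x : TX).

Definition envop y h x : R := \int[Q (y, x)]_z h z.

Lemma bounded_mfun_envop y h : bounded_mfun h -> bounded_mfun (envop y h).
Proof.
move=> bh; have my : measurable_fun setT (fun x : TX => (y, x)) by exact: pair1_measurable.
have := bounded_mfun_kernel (pkpull Q my) (f := fun z => h z.2).
by apply; apply: (bounded_mfun_comp measurable_snd bh).
Qed.

Lemma unit_mfun_envop y h : unit_mfun h -> unit_mfun (envop y h).
Proof.
move=> bh; have my : measurable_fun setT (fun x : TX => (y, x)) by exact: pair1_measurable.
have := unit_mfun_kernel (pkpull Q my) (f := fun z => h z.2).
by apply; apply: (unit_mfun_comp measurable_snd bh).
Qed.

Lemma unit_mfun_envop_joint {d} {S : measurableType d} (y : S -> TY)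
    (f : S * TX -> R) : measurable_fun setT y -> unit_mfun f ->
  unit_mfun (fun p : S * TX => envop (y p.1) (fun z => f (p.1, z)) p.2).
Proof.
move=> my uf.
have mp : measurable_fun setT (fun p : S * TX => (y p.1, p.2)).
  by apply: measurable_fun_pair => //; exact: measurableT_comp.
apply: (unit_mfun_kernel (pkpull Q mp) (f := fun z => f (z.1.1, z.2))).
apply: (@unit_mfun_comp _ _ _ _ _ (fun z : (S * TX) * TX => (z.1.1, z.2)) _ f) => //.
by apply: measurable_fun_pair => //; exact: measurableT_comp.
Qed.

Lemma envop_cst y (c : R) x : envop y (fun=> c) x = c.
Proof. by rewrite /envop Exp_cst//; exact: pkerT. Qed.

Lemma envopD y h g x : bounded_mfun h -> bounded_mfun g ->
  envop y (fun z => h z + g z) x = envop y h x + envop y g x.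
Proof. by move=> bh bg; rewrite /envop ExpD//; exact: pkerT. Qed.

Lemma envopZ y (c : R) h x : bounded_mfun h ->
  envop y (fun z => c * h z) x = c * envop y h x.
Proof. by move=> bh; rewrite /envop ExpZ//; exact: pkerT. Qed.

Lemma le_envop y h g x : bounded_mfun h -> bounded_mfun g ->
  (forall z, h z <= g z) -> envop y h x <= envop y g x.
Proof. by move=> bh bg hg; apply: le_Exp => //; exact: pkerT. Qed.

Variables (V : TX -> R) (gamma K : TY -> R).
Hypothesis driftV : drift Q V gamma K.

Lemma envop_drift y h x (u w : R) : unit_mfun h -> 0 <= u -> 0 <= w ->
  (forall z, h z <= u * V z + w) -> envop y h x <= u * (gamma y * V x + K y) + w.
Proof.
move=> uh u0 w0 hV; have [[mV V0] _ _ dr] := driftV.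
rewrite -lee_fin /envop Rintegral_EFin; [|exact: pkerT|exact: unit_bounded_mfun].
apply: (@le_trans _ _ (\int[Q (y, x)]_z (u%:E * (V z)%:E + w%:E))%E).
  apply: ge0_le_integral => //.
  - by move=> z _; rewrite lee_fin; case/andP: (uh.2 z).
  - by apply/measurable_EFinP; exact: uh.1.
  - apply: emeasurable_funD => //; apply: measurable_funeM.
    exact/measurable_EFinP.
  - by move=> z _; rewrite -EFinM -EFinD lee_fin.
rewrite ge0_integralD//=; first last.
- by apply: measurable_funeM; exact/measurable_EFinP.
- by move=> z _; rewrite -EFinM lee_fin mulr_ge0.
rewrite integral_cst// pkerT mule1 EFinD leeD2r//.
rewrite ge0_integralZl//; first last.
- by move=> z _; rewrite lee_fin.
- exact/measurable_EFinP.
by rewrite EFinM lee_wpmul2l ?lee_fin//; exact: dr.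
Qed.

Variable beta : R -> TY -> R.
Hypothesis minorV : minorization Q V beta.

(** Doeblin's argument on functions: minorizing the average of [h] gives the lower bound and
    minorizing that of [1 - h] the upper one, so the averages oscillate by at most [b] over the
    small set. *)
Lemma envop_minorized (r b : R) y h : 0 < r -> b < 1 -> beta r y <= b -> unit_mfun h ->
  exists c, 0 <= c <= 1 - b /\
    forall x, V x <= r -> c <= envop y h x <= c + b.
Proof.
move=> r0 b1 byb uh; have [_ beta01 /(_ _ r0)[kappa kP]] := minorV.
have bh := unit_bounded_mfun uh.
have k1 : kappa y setT = 1%E by exact: pkerT.
have q1 x : Q (y, x) setT = 1%E by exact: pkerT.
have b0 : 0 <= 1 - b by lra.
exists ((1 - b) * (\int[kappa y]_z h z)); split.
  have /andP[k0 k1'] := Exp_unit k1 uh.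
  by rewrite mulr_ge0//= ler_piMr.
move=> x Vx.
have min A : measurable A -> ((1 - b)%:E * kappa y A <= Q (y, x) A)%E.
  move=> mA; apply: (le_trans _ (kP _ _ _ Vx mA)).
  by rewrite lee_wpmul2r// lee_fin; lra.
rewrite (Exp_minorized (q1 x) k1 b0 min uh)/=.
have := Exp_minorized (q1 x) k1 b0 min (unit_mfun_compl uh).
rewrite !ExpB//; try exact: bounded_mfun_cst.
rewrite !Exp_cst// /envop; lra.
Qed.

End environment_operator.

(** * Deterministic forgetting along a fixed environment *)

Section environment_iteration.
Context {dX dY : measure_display} {TX : measurableType dX} {TY : measurableType dY}
  {R : realType}.
Variable Q : R.-pker (TY * TX)%type ~> TX.
Implicit Types (h g : TX -> R) (y : nat -> TY) (x : TX).

(** [y 0] drives the first step of the chain, hence the outermost average; [enviterS] peels off the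
    last step instead. *)
Fixpoint enviter y n h : TX -> R :=
  if n is m.+1 then envop Q (y 0%N) (enviter (fun k => y k.+1) m h) else h.

Lemma bounded_mfun_enviter y n h : bounded_mfun h -> bounded_mfun (enviter y n h).
Proof. by elim: n y => //= n IH y bh; apply: bounded_mfun_envop; exact: IH. Qed.

Lemma unit_mfun_enviter y n h : unit_mfun h -> unit_mfun (enviter y n h).
Proof. by elim: n y => //= n IH y bh; apply: unit_mfun_envop; exact: IH. Qed.

Lemma enviter_cst y n (c : R) : enviter y n (fun=> c) = fun=> c.
Proof.
elim: n y => //= n IH y; rewrite IH; apply/funext => x; exact: envop_cst.
Qed.

Lemma enviterD y n h g : bounded_mfun h -> bounded_mfun g ->
  enviter y n (fun z => h z + g z) = (fun z => enviter y n h z + enviter y n g z).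
Proof.
move=> bh bg; elim: n y => //= n IH y; rewrite IH; apply/funext => x.
by apply: envopD; exact: bounded_mfun_enviter.
Qed.

Lemma enviterZ y n (c : R) h : bounded_mfun h ->
  enviter y n (fun z => c * h z) = (fun z => c * enviter y n h z).
Proof.
move=> bh; elim: n y => //= n IH y; rewrite IH; apply/funext => x.
by apply: envopZ; exact: bounded_mfun_enviter.
Qed.

Lemma le_enviter y n h g : bounded_mfun h -> bounded_mfun g ->
  (forall z, h z <= g z) -> forall x, enviter y n h x <= enviter y n g x.
Proof.
move=> bh bg hg; elim: n y => //= n IH y x.
by apply: le_envop; [exact: bounded_mfun_enviter..|exact: IH].
Qed.

Lemma enviter_add y m n h :
  enviter y (m + n)%N h = enviter y m (enviter (fun k => y (m + k)%N) n h).
Proof.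
elim: m y => [|m IH] y; first by rewrite add0n.
by rewrite addSn /= IH.
Qed.

Lemma enviterS y n h : enviter y n.+1 h = enviter y n (envop Q (y n) h).
Proof. by rewrite -addn1 enviter_add /= addn0. Qed.

(** [S] may carry a sub-sigma-algebra; since only the first [n] environment variables must be
    measurable for it, the lemma also locates the dependence of the average. *)
Lemma unit_mfun_enviter_joint {d} {S : measurableType d} (y : nat -> S -> TY) n
    (f : S * TX -> R) : (forall k, (k < n)%N -> measurable_fun setT (y k)) ->
  unit_mfun f ->
  unit_mfun (fun p : S * TX => enviter (fun k => y k p.1) n (fun z => f (p.1, z)) p.2).
Proof.
elim: n y f => [|n IH] y f my uf /=.
  by rewrite (_ : (fun p => _) = f)//; apply/funext => -[].
apply: (unit_mfun_envop_joint Q (y := y 0%N) (f := fun p =>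
  enviter (fun k => y k.+1 p.1) n (fun z => f (p.1, z)) p.2)); first exact: my.
by apply: (IH (fun k => y k.+1)) => // k kn; exact: my.
Qed.

End environment_iteration.

(** * Products and weighted sums of the iterated drift inequality *)

Section environment_growth.
Context {dY : measure_display} {TY : measurableType dY} {R : realType}.
Variables (gamma K : TY -> R).
Implicit Types (y : nat -> TY).

Definition growth y a b : R := \prod_(a <= k < b) gamma (y k).

(* the terms with index in [a, b[ of the iterated drift bound at time t *)
Definition load y a b t : R := \sum_(a <= l < b) K (y l) * growth y l.+1 t.

Lemma growth_shift y m a b :
  growth y (m + a) (m + b) = growth (fun k => y (m + k)%N) a b.
Proof.
by rewrite /growth (addnC m a) big_addn addKn; apply: eq_bigr => k _; rewrite addnC.
Qed.

Lemma growth_cat y a b c : (a <= b)%N -> (b <= c)%N ->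
  growth y a b * growth y b c = growth y a c.
Proof. by move=> ab bc; rewrite /growth -big_cat_nat. Qed.

Lemma load_shift y m a b t :
  load y (m + a) (m + b) (m + t) = load (fun k => y (m + k)%N) a b t.
Proof.
rewrite /load (addnC m a) big_addn addKn; apply: eq_bigr => k _.
by rewrite addnC -addnS growth_shift.
Qed.

Lemma load_growth y a b c : (b <= c)%N ->
  load y a b b * growth y b c = load y a b c.
Proof.
move=> bc; rewrite /load mulr_suml; apply: eq_big_nat => l /andP[_ lb].
by rewrite -mulrA growth_cat.
Qed.

Lemma load_cat y a b c t : (a <= b)%N -> (b <= c)%N ->
  load y a b t + load y b c t = load y a c t.
Proof. by move=> ab bc; rewrite /load -big_cat_nat. Qed.

Hypothesis gamma_gt0 : forall e, 0 < gamma e.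
Hypothesis K_gt0 : forall e, 0 < K e.

Lemma growth_ge0 y a b : 0 <= growth y a b.
Proof. by apply: prodr_ge0 => k _; exact: ltW. Qed.

Lemma load_ge0 y a b t : 0 <= load y a b t.
Proof. by apply: sumr_ge0 => l _; rewrite mulr_ge0 ?growth_ge0// ltW. Qed.

End environment_growth.

(** * Iterated drift and contraction over blocks *)

Section drift_iteration.
Context {dX dY : measure_display} {TX : measurableType dX} {TY : measurableType dY}
  {R : realType}.
Variable Q : R.-pker (TY * TX)%type ~> TX.
Variables (V : TX -> R) (gamma K : TY -> R).
Hypothesis driftV : drift Q V gamma K.
Implicit Types (h g : TX -> R) (y : nat -> TY) (x : TX).

(** Affine bounds in [V] are stable under each averaging step. Keeping a bounded [h] below the
    affine function avoids iterating averages of the unbounded [V]. *)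
Lemma enviter_drift y n h x (u w : R) : unit_mfun h -> 0 <= u -> 0 <= w ->
  (forall z, h z <= u * V z + w) ->
  enviter Q y n h x <=
    u * (growth gamma y 0 n * V x + load gamma K y 0 n n) + w.
Proof.
move=> uh u0 w0 hV; have [[_ V0] [_ g0] [_ k0] _] := driftV.
elim: n y x => [|n IH] y x /=.
  by rewrite /growth /load !big_nil/= mul1r addr0.
pose y' k := y k.+1.
have g'0 := growth_ge0 g0 y' 0 n; have l'0 := load_ge0 g0 k0 y' 0 n n.
have step : envop Q (y 0%N) (enviter Q y' n h) x <=
    u * growth gamma y' 0 n * (gamma (y 0%N) * V x + K (y 0%N)) +
    (u * load gamma K y' 0 n n + w).
  apply: (envop_drift driftV); [exact: unit_mfun_enviter|exact: mulr_ge0| |].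
    by rewrite addr_ge0// mulr_ge0.
  by move=> z; rewrite addrA -mulrA -mulrDr; exact: IH.
apply: (le_trans step).
have G1 : growth gamma y 0 n.+1 = gamma (y 0%N) * growth gamma y' 0 n.
  by rewrite /growth big_nat_recl.
have L1 : load gamma K y 0 n.+1 n.+1 =
    K (y 0%N) * growth gamma y' 0 n + load gamma K y' 0 n n.
  rewrite /load big_nat_recl//; congr (_ * _ + _).
    by rewrite /growth big_add1.
  by apply: eq_bigr => l _; rewrite /growth big_add1.
by rewrite G1 L1 le_eqVlt; apply/orP; left; apply/eqP; ring.
Qed.

Variable beta : R -> TY -> R.
Hypothesis minorV : minorization Q V beta.
Variables (r theta : R) (L i : nat).
Hypotheses (r_gt0 : 0 < r) (theta_gt0 : 0 < theta) (theta_lt1 : theta < 1) (iL : (i < L)%N).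

(* One attempt at coupling is made at the last step [t] of each block of length
   [L]; only the part of the load produced by the [i] steps before [t] is used
   in the contraction rate, the rest being charged to [leak]. *)
Definition attempt_time k : nat := (k * L + L.-1)%N.

(** The minorization confines averages to an interval of length [1 - theta], which the recent load
    widens at both ends, hence [2 / r]. A large [beta] or a heavy load gives rate 1: the attempt is
    lost but does no harm. *)
Definition rate y t : R :=
  1 - theta * (beta r (y t) <= 1 - theta)%R%:R *
      Num.max 0 (1 - 2 / r * load gamma K y (t - i) t t).

(** In use [v] is the sum of [V] at the two starting states; the factor 2 counts the older load once
    for each of them. *)
Definition leak (v : R) y t : R :=
  theta / r * (v * growth gamma y 0 t + 2 * load gamma K y 0 (t - i) t).

Fixpoint uncoupled (v : R) y k : R :=
  if k is k'.+1 then
    Num.min 1 (rate y (attempt_time k') * uncoupled v y k' + leak v y (attempt_time k'))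
  else 1.

Lemma uncoupledS v y k : uncoupled v y k.+1 =
  Num.min 1 (rate y (attempt_time k) * uncoupled v y k + leak v y (attempt_time k)).
Proof. by []. Qed.

Lemma rate_ge0 y t : 0 <= rate y t <= 1.
Proof.
have [_ [_ g0] [_ k0] _] := driftV.
have l0 := load_ge0 g0 k0 y (t - i) t t.
have r2 : 0 <= 2 / r * load gamma K y (t - i) t t by rewrite mulr_ge0// divr_ge0 ?ltW.
rewrite /rate; case: (_ <= 1 - theta) => /=; rewrite ?mulr1 ?mulr0 ?mul0r ?subr0 ?ler01 ?lexx//.
set m := Num.max _ _; have m0 : 0 <= m by rewrite le_max lexx.
have m1 : m <= 1 by rewrite ge_max ler01/=; lra.
rewrite subr_ge0 gerBl mulr_ile1 ?mulr_ge0 ?(ltW theta_gt0) ?(ltW theta_lt1)//.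
Qed.

Lemma leak_ge0 v y t : 0 <= v -> 0 <= leak v y t.
Proof.
have [_ [_ g0] [_ k0] _] := driftV.
move=> v0; rewrite /leak mulr_ge0 ?divr_ge0 ?(ltW theta_gt0) ?(ltW r_gt0)//.
by rewrite addr_ge0 ?mulr_ge0 ?growth_ge0 ?load_ge0.
Qed.

Lemma uncoupled_unit v y k : 0 <= v -> 0 <= uncoupled v y k <= 1.
Proof.
move=> v0; elim: k => /= [|k /andP[IH _]]; first by rewrite ler01 lexx.
rewrite le_min ler01/= ge_min lexx/= andbT addr_ge0 ?leak_ge0 ?mulr_ge0//.
by have /andP[] := rate_ge0 y (attempt_time k).
Qed.

Lemma le_uncoupled v v' y k : 0 <= v <= v' -> uncoupled v y k <= uncoupled v' y k.
Proof.
move=> /andP[v0 vv']; elim: k => //= k IH.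
rewrite le_min ge_min lexx/= ge_min; apply/orP; right.
apply: lerD; first by apply: ler_wpM2l => //; have /andP[] := rate_ge0 y (attempt_time k).
rewrite /leak ler_wpM2l ?divr_ge0 ?(ltW theta_gt0) ?(ltW r_gt0)// lerD2r.
rewrite ler_wpM2r//; have [_ [_ g0] _ _] := driftV; exact: growth_ge0.
Qed.

(** Seen from the start of the last block, the future average is an affine image, of slope the rate,
    of a unit function [g], up to an error [e]. The induction hypothesis is applied to [g], and the
    averages of [e] over the earlier blocks make up the leak. *)
Lemma enviter_uncoupled x x' y k h : unit_mfun h ->
  enviter Q y (k * L) h x <=
    enviter Q y (k * L) h x' + uncoupled (V x + V x') y k.
Proof.
have [[mV V0] [_ g0] [_ k0] _] := driftV.
have [th0 th1 rr0] := And3 theta_gt0 theta_lt1 r_gt0.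
have v0 : 0 <= V x + V x' by rewrite addr_ge0.
have unit1 n (f : TX -> R) : unit_mfun f ->
    enviter Q y n f x <= enviter Q y n f x' + 1.
  move=> uf; have [_ /(_ x)] := unit_mfun_enviter Q y n uf.
  by have [_ /(_ x')] := unit_mfun_enviter Q y n uf; lra.
elim: k h => [|k IH] h uh; first by rewrite mul0n; exact: unit1.
rewrite uncoupledS; set t := attempt_time k.
rewrite addr_minr le_min; rewrite unit1//=.
have LE : L = L.-1.+1 by case: L iL.
have -> : (k.+1 * L = k * L + L.-1.+1)%N by rewrite -LE mulSn addnC.
rewrite enviter_add.
pose yk l := y (k * L + l)%N; rewrite -/yk enviterS.
rewrite -[yk L.-1]/(y t).
set h' := envop Q (y t) h; set h'' := enviter Q yk L.-1 h'.
have uh' : unit_mfun h' by exact: unit_mfun_envop.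
have uh'' : unit_mfun h'' by exact: unit_mfun_enviter.
have leak0 := leak_ge0 y t v0; have [un0 un1] := andP (uncoupled_unit y k v0).
rewrite /rate; set Z := load gamma K y (t - i) t t.
have Z0 : 0 <= Z by exact: load_ge0.
(* If [beta] is too large, or the recent load too heavy (next case), the rate is 1 and the induction
   hypothesis is applied to [h''] itself. *)
have [bt|_] := boolP (beta r (y t) <= 1 - theta); last first.
  rewrite /= mulr0 mul0r subr0 mul1r (le_trans (IH _ uh''))// lerD2l lerDl; exact: leak0.
rewrite mulr1.
have [Zr|Zr] := leP (1 - 2 / r * Z) 0.
  rewrite mulr0 subr0 mul1r (le_trans (IH _ uh''))// lerD2l lerDl; exact: leak0.
have [c [/andP[c0 c1] hc]] :
    exists c, 0 <= c <= theta /\ forall z, V z <= r -> c <= h' z <= c + (1 - theta).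
  have b1 : 1 - theta < 1 by lra.
  have [c [c01 hc]] := envop_minorized minorV r_gt0 b1 bt uh.
  by exists c; split => //; move: c01; lra.
pose s := theta / r.
have s0 : 0 <= s by rewrite divr_ge0 ?ltW.
have sr : s * r = theta by rewrite /s divfK ?gt_eqF.
have sE : 2 / r * theta = 2 * s by rewrite /s mulrAC mulrA.
(* Since [0 <= c <= theta], a unit function leaves the interval from [c] to [c + 1 - theta] by at
   most [theta], and it does so only where [V > r]; there [s * V] exceeds [theta], as in Markov's
   inequality. *)
pose w z := Num.min theta (s * V z).
have uw : unit_mfun w.
  split; first by apply: measurable_minr => //; exact: measurable_funM.
  move=> z; rewrite /w le_min (ltW theta_gt0) mulr_ge0//= ge_min.
  by rewrite (ltW theta_lt1).
have bw := unit_bounded_mfun uw.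
have h'w z : c - w z <= h' z <= c + (1 - theta) + w z.
  have [_ /(_ z) /andP[h0 h1]] := uh'; have [_ /(_ z) /andP[w0 w1]] := uw.
  have [Vz|Vz] := leP (V z) r.
    by have /andP[? ?] := hc _ Vz; apply/andP; split; lra.
  have -> : w z = theta by rewrite /w min_l// -sr ler_wpM2l// ltW.
  by apply/andP; split; lra.
set w'' := enviter Q yk L.-1 w.
have uw'' : unit_mfun w'' by exact: unit_mfun_enviter.
have bh' := unit_bounded_mfun uh'.
have h''w z : c - w'' z <= h'' z <= c + (1 - theta) + w'' z.
  apply/andP; split.
    rewrite lerBlDr -[leLHS](_ : enviter Q yk L.-1 (fun=> c) z = c); last by rewrite enviter_cst.
    rewrite -[leRHS](_ : enviter Q yk L.-1 (fun z => h' z + w z) z = _); last by rewrite enviterD.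
    apply: le_enviter => [||z']; [exact: bounded_mfun_cst|exact: bounded_mfunD|].
    by have /andP[] := h'w z'; lra.
  rewrite -[leRHS](_ : enviter Q yk L.-1 (fun z => (c + (1 - theta)) + w z) z = _); last first.
    by rewrite enviterD//; [rewrite enviter_cst|exact: bounded_mfun_cst].
  apply: le_enviter => // [|z'].
    by apply: bounded_mfunD => //; exact: bounded_mfun_cst.
  by have /andP[] := h'w z'; lra.
have iL1 : (L.-1 - i <= L.-1)%N by exact: leq_subr.
have tiE : (t - i = k * L + (L.-1 - i))%N.
  by rewrite /t /attempt_time addnBA// -ltnS -LE.
have ZE : Z = load gamma K yk (L.-1 - i) L.-1 L.-1.
  by rewrite /Z tiE /t /attempt_time load_shift.
(* [s * Z] is the part of the drift bound on [w''] that does not depend on the state and comes from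
   the last [i] steps; it goes to the rate, and [e] keeps the excess. *)
pose e z := Num.max 0 (w'' z - s * Z).
have ue : unit_mfun e.
  split.
    by apply: measurable_maxr => //; apply: measurable_funB => //; exact: uw''.1.
  move=> z; rewrite /e le_max lexx/= ge_max ler01/=.
  by have [_ /(_ z)] := uw''; have := mulr_ge0 s0 Z0; lra.
have be := unit_bounded_mfun ue.
have eV z : enviter Q y (k * L) e z <=
    s * (V z * growth gamma y 0 t + load gamma K y 0 (t - i) t).
  pose G := growth gamma yk 0 L.-1; pose Y := load gamma K yk 0 (L.-1 - i) L.-1.
  have G0 : 0 <= G by exact: growth_ge0.
  have Y0 : 0 <= Y by exact: load_ge0.
  have eb z' : e z' <= s * G * V z' + s * Y.
    rewrite /e ge_max; apply/andP; split.
      by apply: addr_ge0; [apply: mulr_ge0; [exact: mulr_ge0|exact: V0]|exact: mulr_ge0].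
    have wb z'' : w z'' <= s * V z'' + 0 by rewrite addr0 /w ge_min lexx orbT.
    have := enviter_drift yk L.-1 z' uw s0 (lexx _) wb.
    rewrite addr0 lerBlDr => /le_trans; apply.
    rewrite -(@load_cat _ _ _ _ _ _ 0 (L.-1 - i))// -/Y -ZE -/G.
    by rewrite le_eqVlt; apply/orP; left; apply/eqP; ring.
  have sG0 := mulr_ge0 s0 G0; have sY0 := mulr_ge0 s0 Y0.
  apply: (le_trans (enviter_drift y (k * L) z ue sG0 sY0 eb)).
  have GE : growth gamma y 0 (k * L) * G = growth gamma y 0 t.
    rewrite /G -growth_shift addn0 growth_cat//.
    by rewrite leq_addr.
  have YE : load gamma K y 0 (k * L) (k * L) * G + Y = load gamma K y 0 (t - i) t.
    rewrite /G /Y -growth_shift -load_shift addn0 load_growth ?leq_addr//.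
    by rewrite load_cat// ?leq_addr// tiE.
  by rewrite -YE -GE le_eqVlt; apply/orP; left; apply/eqP; ring.
pose rho := 1 - theta + 2 * s * Z.
have rhoE : 1 - theta * (1 - 2 / r * Z) = rho.
  by rewrite /rho -sE; ring.
have sZ0 := mulr_ge0 s0 Z0.
have rho0 : 0 < rho by rewrite /rho; nra.
pose c' := c - s * Z.
(* [h''] lies, up to [e], in the interval of length [rho] starting at [c']; [g] is its position
   there, clipped to [0,1]. *)
pose g z := Num.min 1 (Num.max 0 ((h'' z - c') / rho)).
have ug : unit_mfun g.
  split.
    apply: measurable_minr => //; apply: measurable_maxr => //.
    by apply: measurable_funM => //; apply: measurable_funB => //; exact: uh''.1.
  by move=> z; rewrite /g le_min ler01 le_max lexx/= ge_min lexx.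
have bg := unit_bounded_mfun ug; have bh'' := unit_bounded_mfun uh''.
have ge z : c' + rho * g z - e z <= h'' z <= c' + rho * g z + e z.
  have /andP[h1 h2] := h''w z.
  have e1 : w'' z - s * Z <= e z by rewrite /e le_max lexx orbT.
  have e0 : 0 <= e z by have [_ /(_ z) /andP[]] := ue.
  rewrite /g; have [q0|q0] := leP ((h'' z - c') / rho) 0.
    rewrite min_r ?ler01// mulr0 addr0.
    have : h'' z - c' <= 0 by move: q0; rewrite pmulr_lle0 ?invr_gt0.
    by rewrite /c'; move=> ?; apply/andP; split; lra.
  have [q1|q1] := leP 1 ((h'' z - c') / rho).
    rewrite mulr1; move: q1; rewrite ler_pdivlMr// mul1r => q1.
    have rhosZ : rho = 1 - theta + 2 * (s * Z) by rewrite mulrA.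
    by move: q1; rewrite rhosZ /c' => q1; apply/andP; split; lra.
  rewrite mulrC divfK ?gt_eqF//.
  by apply/andP; split; lra.
pose T f := enviter Q y (k * L) f.
have Tup z : T h'' z <= c' + rho * T g z + T e z.
  rewrite -[leRHS](_ : T (fun z => (c' + rho * g z) + e z) z = _); last first.
    rewrite /T enviterD//; last first.
      by apply: bounded_mfunD; [exact: bounded_mfun_cst|exact: bounded_mfunZ].
    rewrite enviterD ?enviterZ ?enviter_cst//; first exact: bounded_mfun_cst.
    exact: bounded_mfunZ.
  apply: le_enviter => // [|z'].
    by do 2 ?apply: bounded_mfunD => //; [exact: bounded_mfun_cst|exact: bounded_mfunZ].
  by case/andP: (ge z').
have Tlo z : c' + rho * T g z <= T h'' z + T e z.
  rewrite -[leRHS](_ : T (fun z => h'' z + e z) z = _); last by rewrite /T enviterD.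
  rewrite -[leLHS](_ : T (fun z => c' + rho * g z) z = _); last first.
    rewrite /T enviterD ?enviterZ ?enviter_cst//; first exact: bounded_mfun_cst.
    exact: bounded_mfunZ.
  apply: le_enviter => [||z'].
  - by apply: bounded_mfunD => //; [exact: bounded_mfun_cst|exact: bounded_mfunZ].
  - exact: bounded_mfunD.
  by case/andP: (ge z'); lra.
(* The upper estimate is used at [x] and the lower one at [x']: the base point [c'] cancels and both
   averages of [e] are paid. *)
have H1 := Tup x; have H2 := Tlo x'.
have H3 := ler_wpM2l (ltW rho0) (IH _ ug); rewrite -/(T g) mulrDr in H3.
have H4 := lerD (eV x) (eV x').
rewrite rhoE -/(T h'') [leak _ _ _](_ : _ = s * (V x * growth gamma y 0 t + load gamma K y 0 (t - i) t) +
  s * (V x' * growth gamma y 0 t + load gamma K y 0 (t - i) t)); last first.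
  by rewrite /leak -/s; ring.
rewrite -/(T e) in H4; lra.
Qed.

End drift_iteration.

(** * Approximate conditioning *)

Section approximate_conditioning.
Context {d d' : measure_display} {Omega : measurableType d} {S : measurableType d'}
  {R : realType}.
Variable P : probability Omega R.
Variables (phi : Omega -> S) (G : set (set Omega)).
Hypotheses (mphi : measurable_fun setT phi) (mG : G `<=` measurable).
Hypothesis phiG : forall B, measurable B -> G (phi @^-1` B).

(* Up to any [e], the conditional probability of [E] given [G] is a function
   of [phi]. *)
Definition approx_cond (E : set Omega) : Prop := forall e : R, 0 < e ->
  exists2 h : S -> R, unit_mfun h & forall H, G H ->
    `|fine (P (E `&` H)) - \int[P]_w (\1_H w * h (phi w))| <= e.

Let P1 : P setT = 1%E := probability_setT P.

Let fP A : measurable A -> (fine (P A))%:E = P A.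
Proof. by move=> mA; rewrite fineK// fin_num_measure. Qed.

Let le_fP A B : measurable A -> measurable B -> A `<=` B -> fine (P A) <= fine (P B).
Proof. by move=> mA mB AB; rewrite -lee_fin !fP// le_measure// inE. Qed.

Let b1 A : measurable A -> bounded_mfun (\1_A : Omega -> R).
Proof. by move=> mA; exact/unit_bounded_mfun/unit_mfun_indic. Qed.

Lemma approx_condT : approx_cond setT.
Proof.
move=> e e0; exists (fun=> 1); first by apply: unit_mfun_cst; rewrite ler01 lexx.
move=> H GH; under eq_Rintegral do rewrite mulr1.
by rewrite Exp_indic ?setTI ?subrr ?normr0 ?ltW//; exact: mG.
Qed.

Lemma approx_condC E : measurable E -> approx_cond E -> approx_cond (~` E).
Proof.
move=> mE aE e e0; have [h uh hE] := aE e e0.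
exists (fun s => 1 - h s); first exact: unit_mfun_compl.
move=> H GH; have mH := mG GH.
have bh : bounded_mfun (h \o phi).
  by apply: bounded_mfun_comp => //; exact: unit_bounded_mfun.
have -> : \int[P]_w (\1_H w * (1 - h (phi w))) =
    fine (P H) - \int[P]_w (\1_H w * h (phi w)).
  rewrite -Exp_indic// -ExpB//; [|exact: b1|by apply: bounded_mfunM => //; exact: b1].
  by apply: eq_Rintegral => w _; rewrite mulrBr mulr1.
have -> : fine (P (~` E `&` H)) = fine (P H) - fine (P (E `&` H)).
  have mEH : measurable (E `&` H) by exact: measurableI.
  have mCH : measurable (~` E `&` H) by apply: measurableI => //; exact: measurableC.
  rewrite -!Exp_indic// -ExpB//; try exact: b1.
  apply: eq_Rintegral => w _; rewrite !indicE !in_setI in_setC.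
  by case: (w \in E); case: (w \in H); rewrite /= ?subrr ?subr0.
rewrite distrC; have -> : forall a b c : R, a - b - (a - c) = c - b by move=> *; ring.
exact: hE.
Qed.

(** A finite subunion misses at most [e / 3] of the mass, uniformly in the test event [H]; the
    approximations of its pieces are added, and the sum is cut at 1 to stay a unit function. *)
Lemma approx_cond_bigcup (F : (set Omega)^nat) : (forall n, measurable (F n)) ->
  trivIset setT F -> (forall n, approx_cond (F n)) -> approx_cond (\bigcup_n F n).
Proof.
move=> mF tF aF e e0.
have mU : measurable (\bigcup_n F n) by exact: bigcup_measurable.
have e3 : 0 < e / 3 by rewrite divr_gt0.
have [n nE] : exists n, fine (P (\bigcup_n F n)) - fine (P (\big[setU/set0]_(k < n) F k)) <= e / 3.
  have : (\sum_(0 <= k < n) P (F k))%E @[n --> \oo] --> (fine (P (\bigcup_n F n)))%:E.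
    by rewrite fP//; exact: measure_semi_sigma_additive.
  move=> /fine_cvgP[_] /cvgrPdist_le /(_ _ e3) [n _ nP]; exists n.
  have := nP n (leqnn n); rewrite /= => /ler_normlP[_].
  rewrite measure_semi_additive_ord_I ?big_mkord//.
  - exact: sub_trivIset tF.
  - exact: bigsetU_measurable.
set U := \big[setU/set0]_(k < n) F k in nE.
have mUn : measurable U by exact: bigsetU_measurable.
have UF : U `<=` \bigcup_n F n.
  by rewrite /U -bigcup_mkord; apply: bigcup_sub => k _; exact: bigcup_sup.
(* [n.+1] is used because [n] may be 0. *)
have en : 0 < e / 3 / n.+1%:R by rewrite divr_gt0.
have /choice[h hP] : forall k, exists h : S -> R, unit_mfun h /\ forall H, G H ->
    `|fine (P (F k `&` H)) - \int[P]_w (\1_H w * h (phi w))| <= e / 3 / n.+1%:R.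
  by move=> k; have [h uh hk] := aF k _ en; exists h.
have uh k : unit_mfun (h k) by exact: (hP k).1.
pose u s := \sum_(0 <= k < n) h k s.
have bu : bounded_mfun u by apply: bounded_mfun_sum => k; exact: unit_bounded_mfun.
have u0 s : 0 <= u s by apply: sumr_ge0 => k _; case/andP: ((uh k).2 s).
have bup : bounded_mfun (u \o phi) by exact: bounded_mfun_comp.
have uP H : G H -> `|fine (P (U `&` H)) - \int[P]_w (\1_H w * u (phi w))| <= e / 3.
  move=> GH.
  have -> : \int[P]_w (\1_H w * u (phi w)) =
      \sum_(0 <= k < n) \int[P]_w (\1_H w * h k (phi w)).
    rewrite -Exp_sum//; last first.
      move=> k; apply: bounded_mfunM; first exact/b1/mG.
      by apply: bounded_mfun_comp => //; exact: unit_bounded_mfun.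
    by apply: eq_Rintegral => w _; rewrite mulr_sumr.
  have -> : fine (P (U `&` H)) = \sum_(0 <= k < n) fine (P (F k `&` H)).
    have -> : U `&` H = \big[setU/set0]_(k < n) (F k `&` H).
      by rewrite /U -(bigcup_mkord n F) setI_bigcupl -(bigcup_mkord n (fun k => F k `&` H)).
    rewrite (measure_semi_additive_ord_I P (F := fun k => F k `&` H))//.
    - by rewrite big_mkord sum_fine// => k _; rewrite fin_num_measure//; apply: measurableI => //; exact: mG.
    - by move=> k _; apply: measurableI => //; exact: mG.
    - exact/trivIset_setIr/(sub_trivIset _ tF).
    - apply: bigsetU_measurable => k _; apply: measurableI => //; exact: mG.
  rewrite -sumrB (le_trans (ler_norm_sum _ _ _))//.
  apply: (@le_trans _ _ (\sum_(0 <= k < n) (e / 3 / n.+1%:R))).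
    by apply: ler_sum => k _; exact: (hP k).2.
  by rewrite sumr_const_nat subn0 -[leLHS]mulr_natr mulrAC ler_pdivrMr ?ltr0n// ler_pM2l// ler_nat.
pose g s := Num.min 1 (u s).
have ug : unit_mfun g by apply: unit_mfun_min1 => //; exact: bu.1.
have bg := unit_bounded_mfun ug.
have bgp : bounded_mfun (g \o phi) by exact: bounded_mfun_comp.
exists g => // H GH; have mH := mG GH.
(* The cut only acts on [H0], which belongs to [G] as a preimage under [phi]. Testing the
   approximation of [U] against [H0] bounds the mean excess of [u] over 1 by [e / 3], the part of
   [U] inside [H0] having at most the mass of [H0]. *)
pose H0 := phi @^-1` [set s | 1 <= u s].
have GH0 : G H0 by apply: phiG; apply: superlevel_measurable; exact: bu.1.
have mH0 := mG GH0.
have bHu H' : measurable H' -> bounded_mfun (fun w => \1_H' w * u (phi w)).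
  by move=> mH'; apply: bounded_mfunM => //; exact: b1.
have bHg : bounded_mfun (fun w => \1_H w * g (phi w)).
  by apply: bounded_mfunM => //; exact: b1.
have H01 w : 0 <= (\1_H w : R) <= 1 by exact: indic01.
have clampE : \int[P]_w (\1_H w * u (phi w)) - \int[P]_w (\1_H w * g (phi w)) <= e / 3.
  have := uP _ GH0; rewrite ler_norml => /andP[H0e _].
  have UH0 : fine (P (U `&` H0)) <= fine (P H0).
    by apply: le_fP; [exact: measurableI|exact: mH0|exact: subIsetr].
  rewrite -ExpB//; last exact: bHu.
  apply: (@le_trans _ _ (\int[P]_w (\1_H0 w * u (phi w) - \1_H0 w))); last first.
    by rewrite ExpB ?Exp_indic//; [lra|exact: bHu|exact: b1].
  apply: le_Exp => //.
  - by apply: bounded_mfunB => //; exact: bHu.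
  - by apply: bounded_mfunB; [exact: bHu|exact: b1].
  move=> w; rewrite -mulrBr -[X in _ <= _ - X]mulr1 -mulrBr /g.
  have [w1|w1] := leP 1 (u (phi w)).
    rewrite [\1_H0 w]indicE mem_set// mul1r ler_piMl ?subr_ge0//.
  rewrite [\1_H0 w]indicE memNset ?mul0r ?subrr ?mulr0//.
  by rewrite /H0/= => /(lt_le_trans w1); rewrite ltxx.
have clamp0 : \int[P]_w (\1_H w * g (phi w)) <= \int[P]_w (\1_H w * u (phi w)).
  apply: le_Exp => //; first exact: bHu.
  move=> w; apply: ler_wpM2l; first by case/andP: (H01 w).
  by rewrite /g ge_min lexx orbT.
have tail : 0 <= fine (P (\bigcup_n F n `&` H)) - fine (P (U `&` H)) <= e / 3.
  have mFH : measurable (\bigcup_n F n `&` H) by exact: measurableI.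
  have mUH : measurable (U `&` H) by exact: measurableI.
  rewrite subr_ge0 le_fP//=; last exact: setSI.
  apply: le_trans nE; rewrite -!Exp_indic// -!ExpB//; try exact: b1.
  apply: le_Exp => //; [by apply: bounded_mfunB; exact: b1..|move=> w].
  rewrite !indicI -mulrBl ler_piMr//.
  rewrite subr_ge0 !indicE; case: (boolP (w \in U)) => // wU.
  by rewrite mem_set//; apply: UF; exact: set_mem.
have := uP _ GH; rewrite !ler_norml => /andP[? ?].
by case/andP: tail => ? ?; apply/andP; split; lra.
Qed.

End approximate_conditioning.

(** * Histories and the Markov property *)

Section sub_sigma_algebra.
Context {d : measure_display} {Omega : measurableType d}.

Lemma g_sigma_sub (T : Type) (G G' : set (set T)) : G `<=` G' -> <<s G >> `<=` <<s G' >>.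
Proof. by move=> GG'; apply: sub_smallest2r => //; exact: smallest_sigma_algebra. Qed.

Lemma measurable_id_sub (G G' : set (set Omega)) : G `<=` <<s G' >> ->
  measurable_fun setT
    (id : g_sigma_algebraType G' -> g_sigma_algebraType G).
Proof.
move=> GG' _ B mB; rewrite setTI; move: B mB.
by apply: smallest_sub => //; exact: smallest_sigma_algebra.
Qed.

Lemma measurable_id_ambient (G : set (set Omega)) : G `<=` measurable ->
  measurable_fun setT (id : Omega -> g_sigma_algebraType G).
Proof.
move=> Gm _ B mB; rewrite setTI; move: B mB.
by apply: smallest_sub => //; exact: sigma_algebra_measurable.
Qed.

End sub_sigma_algebra.

Section processes.
Context {d dX dY : measure_display} {Omega : measurableType d}
  {TX : measurableType dX} {TY : measurableType dY} {R : realType}.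
Variable P : probability Omega R.
Variables (X : int -> {RV P >-> TX}) (Y : int -> {RV P >-> TY}).
Implicit Types (J I : set int) (s t : int).

Definition history J I : set (set Omega) := events J X `|` events I Y.

Lemma history_measurable J I : history J I `<=` measurable.
Proof.
by move=> A [|] [k _] [B mB <-]; rewrite setTI; exact: measurable_funPTI.
Qed.

Lemma sigma_history_measurable J I : <<s history J I >> `<=` measurable.
Proof.
apply: smallest_sub; first exact: sigma_algebra_measurable.
exact: history_measurable.
Qed.

Lemma history_sub J1 I1 J2 I2 : J1 `<=` J2 -> I1 `<=` I2 ->
  history J1 I1 `<=` history J2 I2.
Proof.
by move=> H H' A [|] [k Jk kA]; [left|right]; exists k => //; [exact: H|exact: H'].
Qed.

Lemma sigma_history_sub J1 I1 J2 I2 : J1 `<=` J2 -> I1 `<=` I2 ->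
  <<s history J1 I1 >> `<=` <<s history J2 I2 >>.
Proof. by move=> H H'; apply: g_sigma_sub; exact: history_sub. Qed.

Lemma measurable_history_sub J1 I1 J2 I2 : J1 `<=` J2 -> I1 `<=` I2 ->
  measurable_fun setT
    (id : g_sigma_algebraType (history J2 I2) -> g_sigma_algebraType (history J1 I1)).
Proof.
move=> H H'; apply: measurable_id_sub.
by move=> A /(history_sub H H') HA; exact: sub_sigma_algebra.
Qed.

Lemma measurable_history J I :
  measurable_fun setT (id : Omega -> g_sigma_algebraType (history J I)).
Proof. by apply: measurable_id_ambient; exact: history_measurable. Qed.

Lemma historyX J I k : J k ->
  measurable_fun setT (X k : g_sigma_algebraType (history J I) -> TX).
Proof.
move=> Jk _ B mB; rewrite setTI; apply: sub_sigma_algebra; left; exists k => //.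
by exists B => //; rewrite setTI.
Qed.

Lemma historyY J I k : I k ->
  measurable_fun setT (Y k : g_sigma_algebraType (history J I) -> TY).
Proof.
move=> Jk _ B mB; rewrite setTI; apply: sub_sigma_algebra; right; exists k => //.
by exists B => //; rewrite setTI.
Qed.

Lemma history_setI J I A B :
  <<s history J I >> A -> <<s history J I >> B -> <<s history J I >> (A `&` B).
Proof.
move=> mA mB.
exact: (@measurableI _ (g_sigma_algebraType (history J I)) A B mA mB).
Qed.

Lemma history_preimageX J I k B : J k -> measurable B ->
  <<s history J I >> (X k @^-1` B).
Proof.
by move=> Jk mB; rewrite -[_ @^-1` _]setTI; apply: (@historyX J I k Jk).
Qed.

Definition upto t : set int := [set k | (k <= t)%R].
Definition from t : set int := [set k | (t <= k)%R].

Definition window s m (B : int -> set TX) : set Omega :=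
  [set w | forall j, (j < m)%N -> B (s + j%:Z) (X (s + j%:Z) w)].

Lemma windowS s m B :
  window s m.+1 B = X s @^-1` (B s) `&` window (s + 1) m B.
Proof.
apply/seteqP; split => w /=.
  move=> wB; split; first by have := wB 0%N; rewrite addr0; exact.
  by move=> j jm; have := wB j.+1 jm; rewrite intS addrA.
move=> [w0 wB] [_|j jm]; first by rewrite addr0.
by rewrite intS addrA; exact: wB.
Qed.

Lemma window_measurable s m B : (forall k, measurable (B k)) ->
  measurable (window s m B).
Proof.
move=> mB; elim: m s => [|m IH] s.
  by rewrite (_ : window s 0 B = setT)//; apply/seteqP; split.
by rewrite windowS; apply: measurableI => //; exact: measurable_funPTI.
Qed.

(** A pi-system whose sigma-algebra contains the history. The constraints are indexed by all
    integers and trivial outside a bounded range, so that two cylinders are intersected coordinate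
    by coordinate. *)
Definition cylinders J I : set (set Omega) := [set A |
  exists D (B : int -> set TX), [/\ <<s history set0 I >> D,
    forall k, measurable (B k),
    forall k, ~ J k -> B k = setT,
    exists m : nat, forall k, (m < `|k|)%N -> B k = setT &
    A = D `&` [set w | forall k, B k (X k w)]]].

Lemma cylinders_setI J I : setI_closed (cylinders J I).
Proof.
move=> _ _ [D [B [mD mB BJ [m Bm] ->]]] [D' [B' [mD' mB' BI [m' Bm'] ->]]].
exists (D `&` D'), (fun k => B k `&` B' k); split.
- exact: history_setI.
- by move=> k; exact: measurableI.
- by move=> k Jk; rewrite BJ// BI// setTI.
- exists (maxn m m') => k; rewrite gtn_max => /andP[mk mk'].
  by rewrite Bm// Bm'// setTI.
- apply/seteqP; split => w /=.
    by move=> [[Dw H] [Dw' H']]; split => [//|k]; split.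
  by move=> [[Dw Dw'] H]; split; (split; first by []) => k; case: (H k).
Qed.

Lemma history_cylinders J I : history J I `<=` cylinders J I.
Proof.
move=> A [|] [k Jk] [B mB <-]; rewrite setTI.
  exists setT, (fun j => if j == k then B else setT); split.
  - exact: (@measurableT _ (g_sigma_algebraType (history set0 I))).
  - by move=> j; case: ifP.
  - by move=> j Jj; case: eqP => // jk; rewrite jk in Jj.
  - by exists `|k|%N => j kj; case: eqP => // jk; move: kj; rewrite jk ltnn.
  - rewrite setTI; apply/seteqP; split => w /=.
      by move=> wB j; case: eqP => [->|].
    by move=> /(_ k); rewrite eqxx.
exists (Y k @^-1` B), (fun=> setT); split => //.
- by apply: sub_sigma_algebra; right; exists k => //; exists B; rewrite ?setTI.
- by exists 0%N.
- by apply/seteqP; split => w //= -[].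
Qed.

Lemma sigma_history_cylinders J I :
  <<s history J I >> `<=` <<s cylinders J I >>.
Proof. by apply: g_sigma_sub; exact: history_cylinders. Qed.

Lemma cylinder_window (B : int -> set TX) s (m : nat) :
  (forall k, ~ (s <= k < s + m%:Z)%R -> B k = setT) ->
  [set w | forall k, B k (X k w)] = window s m B.
Proof.
move=> BT; apply/seteqP; split => w /= wB; first by move=> j _; exact: wB.
move=> k; have [/andP[sk ks]|/BT ->//] := pselect (s <= k < s + m%:Z)%R.
have -> : k = s + `|k - s|%N%:Z by rewrite gez0_abs ?subr_ge0// addrCA subrr addr0.
apply: wB; rewrite -ltz_nat gez0_abs ?subr_ge0//.
by rewrite ltrBlDl.
Qed.

Variable Q : R.-pker (TY * TX)%type ~> TX.
Hypothesis mcre : MCRE Q X Y.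

Let P1 : P setT = 1%E := probability_setT P.

Notation "'OmegaY' J" := (g_sigma_algebraType (history set0 J)) (at level 10).

Lemma measurable_history_pair J s :
  measurable_fun setT (fun w => (w, X s w) : OmegaY J * TX).
Proof.
apply: measurable_fun_pair; last exact: measurable_funPT.
exact: measurable_history.
Qed.

Lemma measurable_kernel_section s (C : set (OmegaY setT * TX)) : measurable C ->
  measurable_fun setT (fun w => Q (Y s w, X s w) (xsection C w)).
Proof.
move=> mC.
have mg : measurable_fun setT (fun w : Omega => (Y s w, X s w)).
  by apply: measurable_fun_pair; exact: measurable_funPT.
have mi : measurable_fun setT
    (fun p : Omega * TX => (p.1, p.2) : OmegaY setT * TX).
  apply: measurable_fun_pair => //.
  exact: (measurableT_comp (@measurable_history set0 setT) measurable_fst).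
have mC' : measurable ([set p | C (p.1, p.2)] : set (Omega * TX)).
  by have := mi measurableT C mC; rewrite setTI.
have := @measurable_fun_xsection_finite_kernel _ _ _ _ _ (pkpull Q mg) _ (mem_set mC').
apply: eq_measurable_fun => w _ /=; congr (Q _ _).
Qed.

(** The conditioning contains the whole environment, which may thus be frozen in the event on the
    next state: for a rectangle the environment factor is absorbed into [G], and Dynkin's argument
    gives all [C]. *)
Lemma MCRE_indic s G (C : set (OmegaY setT * TX)) : <<s history (upto s) setT >> G ->
  measurable C ->
  (P (G `&` [set w | C (w, X (s + 1)%R w)]) =
    \int[P]_(w in G) Q (Y s w, X s w) (xsection C w))%E.
Proof.
move=> GG; have mG := sigma_history_measurable GG.
have mCX (C' : set (OmegaY setT * TX)) : measurable C' -> measurable [set w | C' ((w, X (s + 1) w) : OmegaY setT * TX)].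
  by move=> mC'; have := @measurable_history_pair setT (s + 1) measurableT _ mC'; rewrite setTI.
have mQ (C' : set (OmegaY setT * TX)) : measurable C' ->
    measurable_fun G (fun w => Q (Y s w, X s w) (xsection C' w)).
  by move=> mC'; apply: measurable_funTS; exact: (measurable_kernel_section s mC').
have mxs (C' : set (OmegaY setT * TX)) w : measurable C' -> measurable (xsection C' w).
  by exact: measurable_xsection.
rewrite measurable_prod_measurableType; move: C; apply: dynkin_induction.
- exact: measurable_prod_measurableType.
- move=> _ _ [A mA [B mB <-]] [A' mA' [B' mB' <-]].
  exists (A `&` A'); first exact: measurableI.
  exists (B `&` B'); first exact: measurableI.
  by rewrite setXI.
- under eq_integral do rewrite xsectionE preimage_setT pkerT.
  by rewrite integral_cst// mul1e (_ : [set w | _] = setT) ?setIT//; apply/seteqP; split.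
- move=> _ [D mD [B mB <-]].
  have GD : <<s history (upto s) setT >> (G `&` D).
    by apply: history_setI => //; exact: (@sigma_history_sub set0 setT).
  have mD' := sigma_history_measurable mD.
  have [_ /(_ _ GD)] := mcre s mB.
  rewrite integral_mkcondr => MC.
  rewrite (_ : G `&` _ = X (s + 1) @^-1` B `&` (G `&` D)); last first.
    by apply/seteqP; split => w /= [] => [? []|? []].
  rewrite -MC; apply: eq_integral => w _; rewrite patchE.
  have [Dw|Dw] := boolP (w \in D).
    by rewrite in_xsectionX.
  by rewrite notin_xsectionX// measure0.
- move=> C mC IH.
  have mCC : measurable (~` C) by exact: measurableC.
  have fG : P G \is a fin_num by rewrite fin_num_measure.
  have mGC : measurable (G `&` [set w | C (w, X (s + 1) w)]).
    by apply: measurableI => //; exact: mCX.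
  have mGCC : measurable (G `&` [set w | (~` C) (w, X (s + 1) w)]).
    by apply: measurableI => //; exact: mCX.
  have fC : P (G `&` [set w | C (w, X (s + 1) w)]) \is a fin_num.
    by rewrite fin_num_measure.
  (* Once the finite probability for [C] is added, both sides become [P G]. *)
  apply: etrans (esym (addeK _ fC)) _; apply/esym.
  apply: etrans (esym (addeK _ fC)) _; apply/esym; congr (_ - _)%E.
  rewrite -measureU//; last first.
    by apply/seteqP; split => w //= [] [_ ?] [_]; exact.
  rewrite -setIUr IH -ge0_integralD//; [|exact: mQ..].
  have Q1 w : (Q (Y s w, X s w) (xsection (~` C) w) + Q (Y s w, X s w) (xsection C w))%E = 1%E.
    rewrite -measureU//; [|exact: mxs..|]; last first.
      by rewrite !xsectionE -preimage_setI setICl preimage_set0.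
    by rewrite !xsectionE -preimage_setU setUCl preimage_setT; exact: pkerT.
  under eq_integral do rewrite Q1.
  rewrite integral_cst// mul1e; congr (P _).
  by apply/seteqP; split => [w []//|w Gw]; split => //=; have [?|?] := EM (C (w, X (s + 1) w)); [right|left].
- move=> F mF tF IH.
  rewrite (_ : G `&` _ = \bigcup_n (G `&` [set w | F n (w, X (s + 1) w)])); last first.
    apply/seteqP; split => w /=; first by move=> [Gw [n _ Fn]]; exists n.
    by move=> [n _ [Gw Fn]]; split => //; exists n.
  rewrite measure_semi_bigcup//; first last.
  + by apply: bigcup_measurable => n _; apply: measurableI => //; exact: mCX.
  + apply/trivIsetP => i j _ _ ij; move/trivIsetP : tF => /(_ i j Logic.I Logic.I ij) Fij.
    apply/seteqP; split => w //= [[_ Fi] [_ Fj]].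
    by have : (F i `&` F j) (w, X (s + 1) w) by []; rewrite Fij.
  + by move=> n; apply: measurableI => //; exact: mCX.
  transitivity (\sum_(n <oo) \int[P]_(w in G) Q (Y s w, X s w) (xsection (F n) w))%E.
    by apply: eq_eseriesr => n _; exact: IH.
  rewrite -integral_nneseries//; last by move=> n; exact: mQ.
  apply: eq_integral => w _; rewrite xsection_bigcup measure_semi_bigcup//.
  + by move=> n; exact: mxs.
  + exact: trivIset_xsection.
  + by apply: bigcup_measurable => n _; exact: mxs.
Qed.

(** The difference of the two sides is a bounded linear functional of [f] that vanishes on
    indicators by [MCRE_indic], so [functional_bound] applies with bound 0. *)
Lemma MCRE_step s G (f : OmegaY setT * TX -> R) : <<s history (upto s) setT >> G ->
  unit_mfun f ->
  \int[P]_w (\1_G w * f (w, X (s + 1) w)) =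
  \int[P]_w (\1_G w * envop Q (Y s w) (fun z => f (w, z)) (X s w)).
Proof.
move=> GG; have mG := sigma_history_measurable GG.
have b1 A : measurable A -> bounded_mfun (\1_A : Omega -> R).
  by move=> mA; exact/unit_bounded_mfun/unit_mfun_indic.
pose lhs (f : OmegaY setT * TX -> R) w := \1_G w * f (w, X (s + 1) w).
pose op (f : OmegaY setT * TX -> R) w := envop Q (Y s w) (fun z => f (w, z)) (X s w).
have blhs g : bounded_mfun g -> bounded_mfun (lhs g).
  move=> bg; apply: bounded_mfunM; first exact: b1.
  exact: (bounded_mfun_comp (@measurable_history_pair _ _)).
have mg : measurable_fun setT (fun w : Omega => (Y s w, X s w)).
  by apply: measurable_fun_pair; exact: measurable_funPT.
have mi : measurable_fun setT
    (fun p : Omega * TX => (p.1, p.2) : OmegaY setT * TX).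
  apply: measurable_fun_pair => //.
  exact: (measurableT_comp (@measurable_history set0 setT) measurable_fst).
have bop g : bounded_mfun g -> bounded_mfun (op g).
  by move=> bg; exact: (bounded_mfun_kernel (pkpull Q mg) (bounded_mfun_comp mi bg)).
have brhs g : bounded_mfun g -> bounded_mfun (fun w => \1_G w * op g w).
  by move=> bg; apply: bounded_mfunM; [exact: b1|exact: bop].
have bsec g w : bounded_mfun g -> bounded_mfun (fun z => g ((w, z) : OmegaY setT * TX)).
  by move=> [mg' [M gM]]; split; [exact: measurableT_comp|exists M => z; exact: gM].
pose L g := \int[P]_w lhs g w - \int[P]_w (\1_G w * op g w).
have G01 w : 0 <= (\1_G w : R) <= 1 by exact: indic01.
suff : forall f, unit_mfun f -> `|L f| <= 0.
  by move=> /(_ f) + uf => /(_ uf); rewrite normr_le0 subr_eq0 => /eqP.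
apply: (@functional_bound _ _ _ _ 2).
- move=> f1 f2 b1' b2'; rewrite /L.
  rewrite (_ : lhs _ = fun w => lhs f1 w + lhs f2 w); last first.
    by apply/funext => w; rewrite /lhs mulrDr.
  rewrite (_ : (fun w => \1_G w * op _ w) =
      fun w => \1_G w * op f1 w + \1_G w * op f2 w); last first.
    by apply/funext => w; rewrite -mulrDr /op envopD//; exact: bsec.
  by rewrite !ExpD//; [ring|exact: brhs|exact: brhs|exact: blhs|exact: blhs].
- move=> c f1 b1'; rewrite /L.
  rewrite (_ : lhs _ = fun w => c * lhs f1 w); last first.
    by apply/funext => w; rewrite /lhs mulrCA.
  rewrite (_ : (fun w => \1_G w * op _ w) = fun w => c * (\1_G w * op f1 w)); last first.
    by apply/funext => w; rewrite mulrCA /op envopZ//; exact: bsec.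
  by rewrite !ExpZ ?mulrBr//; [exact: brhs|exact: blhs].
- move=> f1 M b1' fM; rewrite /L (le_trans (ler_normB _ _))//.
  have n1 w : `|(\1_G w : R)| <= 1 by rewrite ger0_norm; case/andP: (G01 w).
  have M0 : 0 <= M.
    exact: (le_trans (normr_ge0 _) (fM (point : OmegaY setT, point : TX))).
  rewrite (_ : 2 * M = M + M); last by ring.
  apply: lerD; apply: norm_Exp_le => //; [exact: blhs| |exact: brhs|] => w.
    by rewrite normrM -[M]mul1r ler_pM.
  rewrite normrM -[M]mul1r ler_pM// /op /envop; apply: norm_Exp_le => //.
    exact: pkerT.
  exact: bsec.
- move=> C mC; have := MCRE_indic GG mC.
  have mCX : measurable [set w | C ((w, X (s + 1) w) : OmegaY setT * TX)].
    by have := @measurable_history_pair setT (s + 1) measurableT _ mC; rewrite setTI.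
  have -> : L \1_C = fine (P (G `&` [set w | C (w, X (s + 1) w)])) -
      fine (\int[P]_(w in G) Q (Y s w, X s w) (xsection C w))%E.
    congr (_ - fine _).
      rewrite -Exp_indic//; last exact: measurableI.
      apply: eq_Rintegral => w _; rewrite /lhs indicI/=; congr (_ * _).
    rewrite [RHS]integral_mkcond; apply: eq_integral => w _.
    rewrite patchE indicE; case: (w \in G); last by rewrite mul0r.
    rewrite mul1r /op /envop.
    have -> : \int[Q (Y s w, X s w)]_z (\1_C (w, z)) =
        \int[Q (Y s w, X s w)]_z (\1_(xsection C w) z) :> R.
      apply: eq_Rintegral => z _; rewrite !indicE; congr (_%:R); congr nat_of_bool.
      by apply/idP/idP => [/set_mem Cw|/set_mem/xsectionP Cw]; apply/mem_set => //; apply/xsectionP.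
    have mxs : measurable (xsection C w) by exact: measurable_xsection.
    rewrite Exp_indic// fineK// ge0_fin_numE// (@le_lt_trans _ _ (Q (Y s w, X s w) setT))//.
      by apply: le_measure; rewrite ?inE.
    by rewrite pkerT ltry.
  by move=> <-; rewrite subrr normr0.
Qed.

Lemma MCRE_iter s m G (f : OmegaY setT * TX -> R) : <<s history (upto s) setT >> G ->
  unit_mfun f ->
  \int[P]_w (\1_G w * f (w, X (s + m%:Z) w)) =
  \int[P]_w (\1_G w *
    enviter Q (fun k => Y (s + k%:Z) w) m (fun z => f (w, z)) (X s w)).
Proof.
move=> GG; elim: m f => [|m IH] f uf.
  by rewrite addr0.
have GG' : <<s history (upto (s + m%:Z)) setT >> G.
  apply: (@sigma_history_sub (upto s) setT) GG => // k; rewrite /upto/= => /le_trans; apply.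
  by rewrite lerDl.
rewrite -addn1 PoszD addrA (MCRE_step GG')//.
pose g (p : OmegaY setT * TX) := envop Q (Y (s + m%:Z) p.1) (fun z => f (p.1, z)) p.2.
have ug : unit_mfun g.
  apply: (unit_mfun_envop_joint Q (y := Y (s + m%:Z) : OmegaY setT -> TY)) => //.
  exact: historyY.
rewrite (IH g ug); apply: eq_Rintegral => w _; congr (_ * _).
by rewrite addn1 enviterS.
Qed.

End processes.

(** * Windows and cylinders *)

Section windows.
Context {d dX dY : measure_display} {Omega : measurableType d}
  {TX : measurableType dX} {TY : measurableType dY} {R : realType}.
Variable P : probability Omega R.
Variables (X : int -> {RV P >-> TX}) (Y : int -> {RV P >-> TY}).
Variable Q : R.-pker (TY * TX)%type ~> TX.
Hypothesis mcre : MCRE Q X Y.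
Implicit Types (J I : set int) (s t : int) (B : int -> set TX).

Notation "'OmegaY' J" := (g_sigma_algebraType (history X Y set0 J)) (at level 10).
Notation past s := (<<s history X Y (upto s) setT >>).

(* the conditional probability of [window s m B] given the past of [X] up to
   time [s] and the whole environment, as a function of the environment and of [X s] *)
Fixpoint window_prob s m B (p : Omega * TX) : R :=
  if m is m'.+1 then
    \1_(B s) p.2 * envop Q (Y s p.1) (fun z => window_prob (s + 1) m' B (p.1, z)) p.2
  else 1.

Lemma unit_mfun_window_prob J s m B : (forall k, measurable (B k)) ->
  (forall j, (j < m)%N -> J (s + j%:Z)) ->
  unit_mfun (window_prob s m B : OmegaY J * TX -> R).
Proof.
move=> mB; elim: m s => [|m IH] s Js /=.
  by apply: unit_mfun_cst; rewrite ler01 lexx.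
apply: unit_mfunM.
  exact: (unit_mfun_comp measurable_snd (unit_mfun_indic (mB s))).
apply: (unit_mfun_envop_joint Q (y := Y s : OmegaY J -> TY)).
  by apply: historyY; have := Js 0%N isT; rewrite addr0.
apply: (IH (s + 1)) => j jm; have := Js j.+1 jm.
by rewrite intS addrA.
Qed.

Lemma past_le s s' : (s <= s')%R -> past s `<=` past s'.
Proof.
by move=> ss'; apply: sigma_history_sub => // k; rewrite /upto/= => /le_trans; exact.
Qed.

Lemma env_past s J : <<s history X Y set0 J >> `<=` past s.
Proof. exact: sigma_history_sub. Qed.

Let mpast s G : past s G -> measurable G.
Proof. exact: sigma_history_measurable. Qed.

Lemma window_probE s m B G : (forall k, measurable (B k)) -> past s G ->
  fine (P (G `&` window X s m B)) = \int[P]_w (\1_G w * window_prob s m B (w, X s w)).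
Proof.
move=> mB; elim: m s G => [|m IH] s G sG.
  rewrite (_ : window X s 0 B = setT); last by apply/seteqP; split.
  rewrite setIT; under eq_Rintegral do rewrite mulr1.
  by rewrite Exp_indic//; exact: (mpast sG).
rewrite windowS setIA.
have GB : past s (G `&` X s @^-1` B s).
  apply: history_setI => //; apply: history_preimageX => //.
  by rewrite /upto/=.
rewrite IH; last by apply: (@past_le s) GB; rewrite lerDl.
rewrite (MCRE_step mcre GB); last by exact: (unit_mfun_window_prob (J := setT)).
apply: eq_Rintegral => w _ /=; rewrite mulrA indicI; congr (_ * _ * _).
Qed.

(** The length is chosen so that the window reaches [m0] whatever the sign of [s]. *)
Lemma cylinder_future_window s (B : int -> set TX) (m0 : nat) :
  (forall k, ~ from s k -> B k = setT) ->
  (forall k, (m0 < `|k|)%N -> B k = setT) ->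
  [set w | forall k, B k (X k w)] = window X s (m0 + `|s|).+1 B.
Proof.
move=> Bs Bm; apply: cylinder_window => k /negP ks.
have [sk|sk] := leP s k; last by apply: Bs; rewrite /from/=; apply/negP; rewrite -ltNge.
apply: Bm; move: ks; rewrite sk/=; lia.
Qed.

Lemma cylinder_past_window t (B : int -> set TX) (m0 : nat) :
  (forall k, ~ upto t k -> B k = setT) ->
  (forall k, (m0 < `|k|)%N -> B k = setT) ->
  [set w | forall k, B k (X k w)] =
  window X (t - (m0 + `|t|)%:Z) (m0 + `|t|).+1 B.
Proof.
move=> Bs Bm; apply: cylinder_window => k /negP ks.
have [sk|sk] := leP k t; last by apply: Bs; rewrite /upto/=; apply/negP; rewrite -ltNge.
apply: Bm; move: ks sk; lia.
Qed.

Lemma cylinders_measurable J I : cylinders X Y J I `<=` measurable.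
Proof.
move=> _ [D [B [mD mB _ [m Bm] ->]]]; apply: measurableI.
  exact: sigma_history_measurable mD.
rewrite (@cylinder_window _ _ _ _ _ _ _ B (- m%:Z) (m + m).+1).
  exact: window_measurable.
by move=> k /negP km; apply: Bm; move: km; lia.
Qed.

Lemma cylinders_approx {d'} (S : measurableType d') (phi : Omega -> S) J I
  (G : set (set Omega)) : measurable_fun setT phi -> G `<=` measurable ->
  (forall C, measurable C -> G (phi @^-1` C)) ->
  cylinders X Y J I `<=` approx_cond P phi G ->
  <<s history X Y J I >> `<=` approx_cond P phi G.
Proof.
move=> mphi mG phiG cG A /sigma_history_cylinders.
suff : forall A, <<s cylinders X Y J I >> A -> measurable A /\ approx_cond P phi G A.
  by move=> /[apply] -[].
apply: (@dynkin_induction _ (g_sigma_algebraType (cylinders X Y J I))) => //.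
- by move=> A1 A2 c1 c2; exact: (cylinders_setI c1 c2).
- by split; [exact: measurableT|exact: approx_condT].
- by move=> C cC; split; [exact: cylinders_measurable cC|exact: cG].
- move=> C _ [mC aC]; split; [exact: measurableC|exact: approx_condC].
- move=> F _ tF aF; split; first by apply: bigcup_measurable => n _; case: (aF n).
  by apply: approx_cond_bigcup => // n; case: (aF n).
Qed.

Lemma past_preimage s J (C : set (OmegaY J * TX)) : measurable C ->
  past s ((fun w => (w, X s w) : OmegaY J * TX) @^-1` C).
Proof.
move=> mC; have mp : measurable_fun setT
    ((fun w => (w, X s w)) : g_sigma_algebraType (history X Y (upto s) setT) -> OmegaY J * TX).
  apply: measurable_fun_pair; first exact: measurable_history_sub.
  by apply: historyX; rewrite /upto/=.
by have := mp measurableT _ mC; rewrite setTI.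
Qed.

(** For a cylinder the formula is exact, the environment event being a factor and the constraints on
    [X] giving [window_prob]; errors arise only in the passage to general events. *)
Lemma future_approx s :
  <<s history X Y (from s) (from s) >> `<=`
  approx_cond P (fun w => (w, X s w) : OmegaY (from s) * TX) (past s).
Proof.
apply: cylinders_approx.
- exact: measurable_history_pair.
- exact: sigma_history_measurable.
- exact: past_preimage.
move=> _ [D [B [mD mB BJ [m0 Bm] ->]]] e e0.
rewrite (cylinder_future_window BJ Bm); set m := (m0 + `|s|).+1.
exists (fun p => \1_D p.1 * window_prob s m B p).
  apply: unit_mfunM.
    exact: (unit_mfun_comp measurable_fst (unit_mfun_indic (T := OmegaY (from s)) mD)).
  by apply: unit_mfun_window_prob => // j _; rewrite /from/= lerDl.
move=> H pH; have HD : past s (H `&` D) by apply: history_setI => //; exact: env_past mD.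
rewrite setIC setIA window_probE// (_ : _ - _ = 0) ?normr0 ?ltW//.
apply/eqP; rewrite subr_eq0; apply/eqP; apply: eq_Rintegral => w _.
by rewrite mulrA indicI.
Qed.

(** A cylinder constrains [X] on a finite window only. Run from [n] steps before that window, the
    chain may be restarted at [x0] at cost [e], and what remains is a function of the environment up
    to [t], although the conditioning is on the whole environment. *)
Lemma past_approx t :
  (forall e : R, 0 < e -> exists x0 n, forall s (f : OmegaY setT * TX -> R), unit_mfun f ->
    \int[P]_w `|enviter Q (fun k => Y (s + k%:Z) w) n (fun z => f (w, z)) (X s w) -
                enviter Q (fun k => Y (s + k%:Z) w) n (fun z => f (w, z)) x0| <= e) ->
  <<s history X Y (upto t) (upto t) >> `<=`
  approx_cond P (id : Omega -> OmegaY (upto t)) <<s history X Y set0 setT >>.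
Proof.
move=> forget; apply: cylinders_approx.
- exact: measurable_history.
- exact: sigma_history_measurable.
- by move=> C mC; exact: (@sigma_history_sub _ _ _ _ _ _ _ _ _ _ set0 (upto t)).
move=> _ [D [B [mD mB BJ [m0 Bm] ->]]] e e0.
have [x0 [n fn]] := forget e e0.
rewrite (cylinder_past_window BJ Bm); set m := (m0 + `|t|).+1.
set s1 := t - (m0 + `|t|)%:Z; pose s := s1 - n%:Z.
have sn : s + n%:Z = s1 by rewrite /s subrK.
pose f J : OmegaY J * TX -> R := window_prob s1 m B.
have uf J : (forall j, (j < m)%N -> J (s1 + j%:Z)) -> unit_mfun (f J).
  by move=> Jj; exact: unit_mfun_window_prob.
have uft : unit_mfun (f (upto t)).
  by apply: uf => j jm; rewrite /upto/= /s1; move: jm; rewrite /m; lia.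
have ufT : unit_mfun (f setT) by exact: uf.
pose g w := enviter Q (fun k => Y (s + k%:Z) w) n (fun z => window_prob s1 m B (w, z)).
have ugx0 : unit_mfun (fun w => g w x0 : R) (T := OmegaY (upto t)).
  have := @unit_mfun_enviter_joint _ _ _ _ _ Q _ (OmegaY (upto t))
    (fun k => Y (s + k%:Z)) n _ _ uft.
  move=> /(_ _)/(unit_mfun_comp (pair2_measurable x0)); apply.
  move=> k kn; apply: historyY; rewrite /upto/= /s /s1; move: kn; lia.
have uD : unit_mfun (\1_D : OmegaY (upto t) -> R) by exact: unit_mfun_indic.
exists (fun w => \1_D w * g w x0); first exact: unit_mfunM.
move=> H mH; have mH' := sigma_history_measurable mH.
have mD' := sigma_history_measurable mD.
have HD : <<s history X Y set0 setT >> (H `&` D).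
  by apply: history_setI => //; exact: (@sigma_history_sub _ _ _ _ _ _ _ _ _ _ set0 (upto t)) mD.
rewrite setIC setIA window_probE//; last exact: env_past HD.
have := MCRE_iter mcre n (@env_past s setT _ HD) ufT.
rewrite sn => ->.
have mid : measurable_fun setT (id : Omega -> OmegaY (upto t)) by exact: measurable_history.
have bg0 : bounded_mfun (fun w => g w x0) (T := Omega).
  exact: (bounded_mfun_comp mid (unit_bounded_mfun ugx0)).
have bgX : bounded_mfun (fun w => g w (X s w)).
  have := @unit_mfun_enviter_joint _ _ _ _ _ Q _ (OmegaY setT)
    (fun k => Y (s + k%:Z)) n _ _ ufT.
  move=> /(_ _)/unit_bounded_mfun/(bounded_mfun_comp (@measurable_history_pair _ _ _ _ _ _ _ P X Y setT s)); apply.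
  by move=> k _; exact: historyY.
have mHD : measurable (H `&` D) by exact: measurableI.
have P1 : P setT = 1%E := probability_setT P.
have b1 A : measurable A -> bounded_mfun (\1_A : Omega -> R).
  by move=> mA; exact/unit_bounded_mfun/unit_mfun_indic.
have bl : bounded_mfun (fun w => \1_(H `&` D) w * g w (X s w)).
  by apply: bounded_mfunM => //; exact: b1.
have br : bounded_mfun (fun w => \1_H w * (\1_D w * g w x0)).
  by do 2 (apply: bounded_mfunM; first exact: b1).
have bd := bounded_mfunB bgX bg0.
rewrite -(ExpB P1 bl br); apply: le_trans (fn s _ ufT).
apply: (le_trans (le_normr_Rintegral _ (bounded_integrable P1 (bounded_mfunB bl br)))) => //.
apply: le_Exp => //.
- exact/bounded_mfun_norm/bounded_mfunB.
- exact/bounded_mfun_norm/bounded_mfunB.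
move=> w; rewrite mulrA indicI/= -mulrBr normrM ler_piMl//.
have /andP[H0 H1] := indic01 (R := R) H w; have /andP[D0 D1] := indic01 (R := R) D w.
by rewrite ger0_norm ?mulr_ge0// mulr_ile1.
Qed.

End windows.

(** * Covariances and stationarity *)

Section mixing_coefficient.
Context {d dT : measure_display} {Omega : measurableType d}
  {T : measurableType dT} {R : realType}.
Variable P : probability Omega R.
Variable W : int -> {RV P >-> T}.

Let mW J : sigma_process J W `<=` measurable.
Proof.
apply: smallest_sub; first exact: sigma_algebra_measurable.
by move=> A [k _] [B mB <-]; rewrite setTI; exact: measurable_funPTI.
Qed.

Lemma covariance_fine A B : measurable A -> measurable B ->
  (`|P (A `&` B) - P A * P B| =
   `|fine (P (A `&` B)) - fine (P A) * fine (P B)|%:E)%E.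
Proof.
move=> mA mB; have mAB : measurable (A `&` B) by exact: measurableI.
rewrite -[in LHS](fineK (fin_num_measure P _ mA)) -[in LHS](fineK (fin_num_measure P _ mB)).
by rewrite -[in LHS](fineK (fin_num_measure P _ mAB)) -EFinM -EFinB abse_EFin.
Qed.

Lemma covariance_le1 A B : measurable A -> measurable B ->
  `|fine (P (A `&` B)) - fine (P A) * fine (P B)| <= 1.
Proof.
move=> mA mB.
have b01 C : measurable C -> 0 <= fine (P C) <= 1.
  move=> mC; rewrite fine_ge0//= -lee_fin fineK ?fin_num_measure//.
  exact: probability_le1.
have /andP[? ?] := b01 _ (measurableI _ _ mA mB).
have /andP[a0 a1] := b01 _ mA; have /andP[b0 b1] := b01 _ mB.
have : 0 <= fine (P A) * fine (P B) <= 1 by rewrite mulr_ge0//= mulr_ile1.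
by rewrite ler_norml; move=> ?; apply/andP; split; lra.
Qed.

Lemma alpha_coef_ge0 n : (0 <= alpha_coef W n)%E.
Proof.
apply: (@le_trans _ _ (alpha_dep P (sigma_process [set k : int | (k <= 0)%R] W)
    (sigma_process [set k : int | (0 + n%:Z <= k)%R] W))).
  apply: (@le_trans _ _ (`|P (set0 `&` set0) - P set0 * P set0|)%E); first exact: abse_ge0.
  apply: ereal_sup_ubound; exists set0; first exact: sigma_algebra0.
  by exists set0; first exact: sigma_algebra0.
by apply: ereal_sup_ubound; exists 0.
Qed.

Lemma alpha_coef_le1 n : (alpha_coef W n <= 1)%E.
Proof.
apply: ge_ereal_sup => _ [j _ <-]; apply: ge_ereal_sup => _ [A /mW mA [B /mW mB <-]].
by rewrite covariance_fine// lee_fin covariance_le1.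
Qed.

Lemma alpha_coef_fineK n : (fine (alpha_coef W n))%:E = alpha_coef W n.
Proof.
rewrite fineK// ge0_fin_numE ?alpha_coef_ge0//.
by rewrite (le_lt_trans (alpha_coef_le1 n))// ltry.
Qed.

Lemma alpha_coefP n t A B :
  sigma_process (upto t) W A -> sigma_process (from (t + n%:Z)) W B ->
  `|fine (P (A `&` B)) - fine (P A) * fine (P B)| <= fine (alpha_coef W n).
Proof.
move=> sA sB; have mA := mW sA; have mB := mW sB.
rewrite -lee_fin alpha_coef_fineK -covariance_fine//.
apply: (@le_trans _ _ (alpha_dep P (sigma_process (upto t) W)
    (sigma_process (from (t + n%:Z)) W))).
  by apply: ereal_sup_ubound; exists A => //; exists B.
by apply: ereal_sup_ubound; exists t.
Qed.

End mixing_coefficient.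

Section covariance_of_functions.
Context {d : measure_display} {Omega : measurableType d} {R : realType}.
Variable P : probability Omega R.
Variables (G1 G2 : set (set Omega)) (a : R).
Hypotheses (mG1 : G1 `<=` measurable) (mG2 : G2 `<=` measurable).
Hypothesis cov12 : forall A B, <<s G1 >> A -> <<s G2 >> B ->
  `|fine (P (A `&` B)) - fine (P A) * fine (P B)| <= a.

Let P1 : P setT = 1%E := probability_setT P.

(* bilinearity reduces covariances of functions to covariances of events *)
Let cov_linear {d'} (S : measurableType d') (phi : Omega -> S)
  (g : Omega -> R) (f : S -> R) (b : R) :
  measurable_fun setT phi -> unit_mfun g -> unit_mfun f ->
  (forall A, measurable A -> `|\int[P]_w (\1_A (phi w) * g w) -
     (\int[P]_w \1_A (phi w)) * \int[P]_w g w| <= b) ->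
  `|\int[P]_w (f (phi w) * g w) - (\int[P]_w f (phi w)) * \int[P]_w g w| <= b.
Proof.
move=> mphi ug uf cb; have bg := unit_bounded_mfun ug.
have bp (h : S -> R) : bounded_mfun h -> bounded_mfun (fun w => h (phi w)).
  exact: bounded_mfun_comp.
have bpg h : bounded_mfun h -> bounded_mfun (fun w => h (phi w) * g w).
  by move=> bh; apply: bounded_mfunM => //; exact: bp.
have /andP[Eg0 Eg1] := Exp_unit P1 ug.
pose L h := \int[P]_w (h (phi w) * g w) - (\int[P]_w h (phi w)) * \int[P]_w g w.
apply: (@functional_bound _ _ _ L 2 b) => //.
- move=> h1 h2 bh1 bh2; rewrite /L.
  under eq_Rintegral do rewrite mulrDl.
  by rewrite (ExpD P1 (bpg _ bh1) (bpg _ bh2)) (ExpD P1 (bp _ bh1) (bp _ bh2)); ring.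
- move=> c h bh; rewrite /L.
  under eq_Rintegral do rewrite -mulrA.
  by rewrite (ExpZ P1 _ (bpg _ bh)) (ExpZ P1 _ (bp _ bh)); ring.
- move=> h M bh hM; rewrite /L (le_trans (ler_normB _ _))//.
  have M0 : 0 <= M by exact: (le_trans (normr_ge0 _) (hM point)).
  rewrite (_ : 2 * M = M + M); last by ring.
  apply: lerD.
    apply: (norm_Exp_le P1); first exact: (bpg _ bh).
    move=> w; rewrite normrM -[M]mulr1 ler_pM//.
    by have [_ /(_ w) /andP[g0 g1]] := ug; rewrite ger0_norm.
  rewrite normrM -[M]mulr1 ler_pM//; last by rewrite ger0_norm.
  by apply: (norm_Exp_le P1) => //; exact: (bp _ bh).
Qed.

(** Treating one argument after the other keeps the constant of the events. The hypotheses on [f]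
    and [g] are measurability for the generated sigma-algebras, carried by their domains. *)
Lemma covariance_functions (f : g_sigma_algebraType G1 -> R)
  (g : g_sigma_algebraType G2 -> R) : unit_mfun f -> unit_mfun g ->
  `|\int[P]_w (f w * g w) - (\int[P]_w f w) * \int[P]_w g w| <= a.
Proof.
move=> uf ug.
have mi1 := measurable_id_ambient mG1; have mi2 := measurable_id_ambient mG2.
have uf' : unit_mfun (f : Omega -> R) := unit_mfun_comp mi1 uf.
have ug' : unit_mfun (g : Omega -> R) := unit_mfun_comp mi2 ug.
apply: (cov_linear mi1 ug' uf) => A mA.
have mA' : measurable (A : set Omega) by have := mi1 measurableT _ mA; rewrite setTI.
have -> : \int[P]_w (\1_A w * g w) = \int[P]_w (g w * \1_A w).
  by apply: eq_Rintegral => w _; rewrite mulrC.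
rewrite [(\int[P]_w \1_A w) * _]mulrC.
apply: (cov_linear mi2 (unit_mfun_indic mA') ug) => B mB.
have mB' : measurable (B : set Omega) by have := mi2 measurableT _ mB; rewrite setTI.
have -> : \int[P]_w (\1_B w * \1_A w) = fine (P (A `&` B)).
  rewrite -Exp_indic//; last exact: measurableI.
  by apply: eq_Rintegral => w _; rewrite indicI mulrC.
by rewrite !Exp_indic// mulrC; exact: cov12.
Qed.

End covariance_of_functions.

Section stationarity.
Context {d dT : measure_display} {Omega : measurableType d}
  {T : measurableType dT} {R : realType}.
Variable P : probability Omega R.
Variable W : int -> {RV P >-> T}.
Hypothesis statW : stationary W.

Lemma stationary_integral n (t : 'I_n -> int) (h : int) (f : n.-tuple T -> \bar R) :
  measurable_fun setT f -> (forall x, 0 <= f x)%E ->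
  (\int[P]_w f [tuple W (t i + h)%R w | i < n] =
   \int[P]_w f [tuple W (t i) w | i < n])%E.
Proof.
move=> mf f0.
have mt (u : 'I_n -> int) : measurable_fun setT (fun w => [tuple W (u i) w | i < n]).
  apply/measurable_fun_tnthP => i.
  rewrite (_ : _ \o _ = W (u i)); first exact: measurable_funPT.
  by apply/funext => w /=; rewrite tnth_mktuple.
have E (u : 'I_n -> int) : (\int[P]_w f [tuple W (u i) w | i < n] =
    \int[pushforward P (fun w => [tuple W (u i) w | i < n])]_x f x)%E.
  by rewrite (ge0_integral_pushforward (mt u)) ?preimage_setT.
rewrite !E; apply: eq_measure_integral => A mA _.
exact: statW.
Qed.

End stationarity.

(** * Causality and moments of the environment *)

Section causality.
Context {d dX dY : measure_display} {Omega : measurableType d}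
  {TX : measurableType dX} {TY : measurableType dY} {R : realType}.
Variable P : probability Omega R.
Variables (X : int -> {RV P >-> TX}) (Y : int -> {RV P >-> TY}).
Variable Q : R.-pker (TY * TX)%type ~> TX.
Hypothesis mcre : MCRE Q X Y.

Lemma history_set0 (J : set int) : history X Y set0 J = events J Y.
Proof. by rewrite /history /events bigcup_set0 set0U. Qed.

Lemma environment_covariance m t A F : <<s history X Y set0 (upto t) >> A ->
  <<s history X Y set0 (from (t + m%:Z)) >> F ->
  `|fine (P (A `&` F)) - fine (P A) * fine (P F)| <= fine (alpha_coef Y m).
Proof. by rewrite !history_set0; exact: alpha_coefP. Qed.

(* The chain run from a fixed state in the remote past is a function of the past
   environment, and by forgetting it approximates [X]. *)
Lemma causal_covariance m t A F :
  (forall e : R, 0 < e -> exists x0 n, forall s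
      (f : g_sigma_algebraType (history X Y set0 setT) * TX -> R), unit_mfun f ->
    \int[P]_w `|enviter Q (fun k => Y (s + k%:Z) w) n (fun z => f (w, z)) (X s w) -
                enviter Q (fun k => Y (s + k%:Z) w) n (fun z => f (w, z)) x0| <= e) ->
  <<s history X Y (upto t) (upto t) >> A ->
  <<s history X Y set0 (from (t + m%:Z)) >> F ->
  `|fine (P (A `&` F)) - fine (P A) * fine (P F)| <= fine (alpha_coef Y m).
Proof.
move=> forget sA sF; apply/ler_addgt0Pr => e e0.
have P1 : P setT = 1%E := probability_setT P.
have e2 : 0 < e / 2 by rewrite divr_gt0.
have [g ug gA] := past_approx mcre forget sA e2.
have sF' : <<s history X Y set0 setT >> F by apply: sigma_history_sub sF.
have mF := sigma_history_measurable sF.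
have := gA _ sF'; have := gA setT (@measurableT _ (g_sigma_algebraType (history X Y set0 setT))).
rewrite setIT; under eq_Rintegral do rewrite indicT mul1r.
have /andP[F0 F1] := Exp_unit P1 (unit_mfun_indic mF).
rewrite Exp_indic// in F0 F1.
have := covariance_functions (@history_measurable _ _ _ _ _ _ _ _ X Y set0 (upto t))
  (@history_measurable _ _ _ _ _ _ _ _ X Y set0 (from (t + m%:Z)))
  (@environment_covariance m t) ug
  (unit_mfun_indic (T := g_sigma_algebraType (history X Y set0 (from (t + m%:Z)))) sF).
rewrite Exp_indic//.
have -> : \int[P]_w (g w * \1_F w) = \int[P]_w (\1_F w * g w).
  by apply: eq_Rintegral => w _; rewrite mulrC.
set x := \int[P]_w (\1_F w * g w); set y := \int[P]_w g w.
set a := fine (alpha_coef Y m); set p := fine (P A); set q := fine (P F).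
move=> H1 H2 H3.
have -> : fine (P (A `&` F)) - p * q =
  (fine (P (A `&` F)) - x) + ((x - y * q) - (p - y) * q) by ring.
have H4 : `|(p - y) * q| <= e / 2.
  by rewrite normrM (ger0_norm F0) -[e / 2]mulr1 ler_pM.
apply: (le_trans (ler_normD _ _)); apply: (@le_trans _ _ (e / 2 + (a + e / 2))).
  apply: lerD => //; apply: (le_trans (ler_normB _ _)); exact: lerD.
by rewrite le_eqVlt; apply/orP; left; apply/eqP; field.
Qed.

End causality.

(** * Moments of the drift products under stationarity *)

Section growth_moments.
Context {d dY : measure_display} {Omega : measurableType d}
  {TY : measurableType dY} {R : realType}.
Variable P : probability Omega R.
Variable Y : int -> {RV P >-> TY}.
Variables (gamma K : TY -> R).
Hypotheses (statY : stationary Y) (mgamma : measurable_fun setT gamma)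
  (mK : measurable_fun setT K).
Hypotheses (gamma_gt0 : forall e, 0 < gamma e) (K_gt0 : forall e, 0 < K e).
Local Notation dc := (d_coef gamma K Y).
Local Notation rc := (r_coef gamma K Y).

Definition env s w : nat -> TY := fun k => Y (s + k%:Z) w.

(** The index [t = -1] of the supremum, where [K] is replaced by 1, is the one that controls pure
    products of [gamma]; stationarity moves it to [s]. *)
Lemma growth_moment s l : (0 < l)%N ->
  (\int[P]_w (growth gamma (env s w) 0 l)%:E <= dc l)%E.
Proof.
case: l => // l _.
pose f (x : l.+1.-tuple TY) : \bar R := (\prod_(i < l.+1) gamma (tnth x i))%:E.
have mf : measurable_fun setT f.
  apply/measurable_EFinP; apply: measurable_prod => i _.
  by apply: measurableT_comp => //; exact: measurable_tnth.
have f0 x : (0 <= f x)%E by rewrite lee_fin; apply: prodr_ge0 => i _; exact: ltW.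
have := stationary_integral statY (fun i : 'I_l.+1 => i%:Z) s mf f0.
have E w h : f [tuple Y ((i : 'I_l.+1)%:Z + h) w | i < l.+1] =
    (growth gamma (env h w) 0 l.+1)%:E.
  rewrite /f /growth big_mkord; congr (_%:E); apply: eq_bigr => i _.
  by rewrite tnth_mktuple /env addrC.
under eq_integral do rewrite E.
move=> ->; apply: ereal_sup_ubound; exists (-1) => //=.
rewrite unlock; apply: eq_integral => w _; congr (_%:E).
rewrite /f /K_env eqxx mul1r big_add1 big_mkord.
apply: eq_bigr => i _; rewrite tnth_mktuple; congr (gamma (Y _ w)).
by rewrite intS addKr.
Qed.

Lemma weighted_growth_moment s l :
  (\int[P]_w (K (env s w 0) * growth gamma (env s w) 1 l.+1)%:E <= dc l)%E.
Proof.
pose f (x : l.+1.-tuple TY) : \bar R :=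
  (K (tnth x ord0) * \prod_(i < l) gamma (tnth x (lift ord0 i)))%:E.
have mf : measurable_fun setT f.
  apply/measurable_EFinP; apply: measurable_funM.
    by apply: measurableT_comp => //; exact: measurable_tnth.
  apply: measurable_prod => i _.
  by apply: measurableT_comp => //; exact: measurable_tnth.
have f0 x : (0 <= f x)%E.
  by rewrite lee_fin mulr_ge0 ?(ltW (K_gt0 _))//; apply: prodr_ge0 => i _; exact: ltW.
have E w h : f [tuple Y ((i : 'I_l.+1)%:Z + h) w | i < l.+1] =
    (K (env h w 0) * growth gamma (env h w) 1 l.+1)%:E.
  rewrite /f /growth big_add1 big_mkord !tnth_mktuple /env.
  congr ((K _ * _)%:E); first by rewrite addrC.
  by apply: eq_bigr => i _; rewrite tnth_mktuple lift0 addrC.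
have shift h : (\int[P]_w (K (env h w 0) * growth gamma (env h w) 1 l.+1)%:E =
    \int[P]_w f [tuple Y ((i : 'I_l.+1)%:Z) w | i < l.+1])%E.
  have := stationary_integral statY (fun i : 'I_l.+1 => i%:Z) h mf f0.
  by under eq_integral do rewrite E.
rewrite shift -(shift 0) {shift E f0 mf f}; case: l => [|l].
  (* For [l = 0] the product is empty, and [K] is bounded by the sum [K + gamma] that defines the
     coefficient of index 0. *)
  apply: (@le_trans _ _ ('E_P[fun w => (K (Y 0 w) + gamma (Y 0 w))%R])%E).
    rewrite unlock; apply: ge0_le_integral => //.
    - by move=> w _; rewrite lee_fin mulr_ge0 ?growth_ge0// ltW.
    - apply/measurable_EFinP; apply: measurable_funM.
        by apply: measurableT_comp => //; exact: measurable_funPT.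
      apply: measurable_prod => k _.
      by apply: measurableT_comp => //; exact: measurable_funPT.
    - apply/measurable_EFinP; apply: measurable_funD;
        by apply: measurableT_comp => //; exact: measurable_funPT.
    move=> w _; rewrite /growth big_geq// mulr1 lee_fin /env addr0 lerDl; exact: ltW.
  by apply: ereal_sup_ubound; exists 0.
apply: ereal_sup_ubound; exists 0 => //=.
by rewrite unlock; apply: eq_integral => w _; rewrite /K_env /env addr0.
Qed.

Lemma d_coef_ge0 l : (0 <= dc l)%E.
Proof.
apply: le_trans (weighted_growth_moment 0 l); apply: integral_ge0 => w _.
by rewrite lee_fin mulr_ge0 ?growth_ge0// ltW.
Qed.

Lemma r_coef_ge0 i : (0 <= rc i)%E.
Proof. by apply: nneseries_ge0 => l _ _; exact: d_coef_ge0. Qed.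

Lemma r_coef_le i j : (i <= j)%N -> (rc j <= rc i)%E.
Proof.
move=> ij; rewrite /r_coef (@nneseries_split _ _ i (j - i)); last by move=> k _; exact: d_coef_ge0.
by rewrite subnKC// leeDr// sume_ge0// => l _; exact: d_coef_ge0.
Qed.

Lemma d_coef_le_r_coef i l : (i <= l)%N -> (dc l <= rc i)%E.
Proof.
move=> il; apply: le_trans (r_coef_le il).
rewrite /r_coef (@nneseries_split _ _ l 1); last by move=> k _; exact: d_coef_ge0.
by rewrite addn1 big_nat1 leeDl// nneseries_ge0// => k _ _; exact: d_coef_ge0.
Qed.

Lemma measurable_growth {d'} {S : measurableType d'} (y : S -> nat -> TY) a b :
  (forall k, (a <= k < b)%N -> measurable_fun setT (fun w => y w k)) ->
  measurable_fun setT (fun w => growth gamma (y w) a b).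
Proof.
move=> my; apply: measurable_prod => k; rewrite mem_index_iota => ab.
by apply: measurableT_comp => //; exact: my.
Qed.

Lemma measurable_load {d'} {S : measurableType d'} (y : S -> nat -> TY) a b t :
  (b <= t)%N ->
  (forall k, (a <= k < t)%N -> measurable_fun setT (fun w => y w k)) ->
  measurable_fun setT (fun w => load gamma K (y w) a b t).
Proof.
move=> bt my; rewrite (_ : (fun w => _) = (fun w => \sum_(l <- index_iota a b)
    if (a <= l < b)%N then K (y w l) * growth gamma (y w) l.+1 t else 0)); last first.
  by apply/funext => w; rewrite /load; apply: eq_big_nat => l ->.
apply: measurable_sum => l; case: (boolP (a <= l < b)%N) => [/andP[al lb]|_]; last exact: measurable_cst.
apply: measurable_funM.
  by apply: measurableT_comp => //; apply: my; rewrite al (leq_trans lb).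
apply: measurable_growth => k /andP[lk kt]; apply: my.
by rewrite kt andbT (leq_trans al)// (leq_trans _ lk).
Qed.

Lemma env_shift s j w : (fun k => env s w (j + k)%N) = env (s + j%:Z) w.
Proof. by apply/funext => k; rewrite /env PoszD addrA. Qed.

Lemma measurable_env s k : measurable_fun setT (fun w => env s w k).
Proof. exact: measurable_funPT. Qed.

(** The term of index [l] has mean at most the coefficient of index [t - l - 1], and for [l] below
    [b] these indices start at [t - b]. *)
Lemma load_moment s a b t : (a <= b <= t)%N ->
  (\int[P]_w (load gamma K (env s w) a b t)%:E <= rc (t - b)%N)%E.
Proof.
move=> /andP[ab bt].
have term l : (l < t)%N ->
    (\int[P]_w (K (env s w l) * growth gamma (env s w) l.+1 t)%:E <= dc (t - l.+1)%N)%E.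
  move=> lt; have := weighted_growth_moment (s + l%:Z) (t - l.+1).
  apply: le_trans; rewrite le_eqVlt; apply/orP; left; apply/eqP.
  apply: eq_integral => w _; congr (_%:E); rewrite -env_shift addn0; congr (_ * _).
  by rewrite -growth_shift addn1 addnS -addSn subnKC.
have mt l : (l < t)%N -> measurable_fun setT
    (fun w => K (env s w l) * growth gamma (env s w) l.+1 t).
  move=> lt; apply: measurable_funM.
    by apply: measurableT_comp => //; exact: measurable_env.
  by apply: measurable_growth => k _; exact: measurable_env.
have t0 l w : 0 <= K (env s w l) * growth gamma (env s w) l.+1 t.
  by rewrite mulr_ge0 ?growth_ge0// ltW.
apply: (@le_trans _ _ (\sum_(t - b <= l < t - a) dc l)%E); last first.
  by apply: nneseries_lim_ge => l _ _; exact: d_coef_ge0.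
have [n bE] : exists n, b = (a + n)%N by exists (b - a)%N; rewrite subnKC.
elim: n a b bE ab bt => [|n IH] a b bE ab bt.
  rewrite bE addn0 big_geq// /load; under eq_integral do rewrite big_geq ?addn0//.
  by rewrite integral0.
have alb : (a < b)%N by rewrite bE addnS ltnS leq_addr.
have at' : (a < t)%N by exact: leq_trans alb bt.
have lE w : load gamma K (env s w) a b t =
    K (env s w a) * growth gamma (env s w) a.+1 t + load gamma K (env s w) a.+1 b t.
  by rewrite /load big_ltn.
under eq_integral do rewrite lE EFinD.
rewrite ge0_integralD//; first last.
- apply/measurable_EFinP; apply: measurable_load => // k _; exact: measurable_env.
- by move=> w _; rewrite lee_fin load_ge0.
- by apply/measurable_EFinP; exact: mt.
- by move=> w _; rewrite lee_fin.
have -> : (t - a = (t - a.+1).+1)%N by rewrite -subSn.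
rewrite big_nat_recr/=; last by apply: leq_sub2l.
rewrite addeC; apply: leeD; last exact: term.
by apply: IH => //; rewrite bE addSnnS.
Qed.

End growth_moments.

(** * Expected non-coupling *)

Section uncoupled_measurability.
Context {dX dY : measure_display} {TX : measurableType dX} {TY : measurableType dY}
  {R : realType}.
Variable Q : R.-pker (TY * TX)%type ~> TX.
Variables (V : TX -> R) (gamma K : TY -> R) (beta : R -> TY -> R).
Hypotheses (driftV : drift Q V gamma K) (minorV : minorization Q V beta).
Variables (r theta : R) (L i : nat).
Hypotheses (r_gt0 : 0 < r) (iL : (i < L)%N).
Context {d : measure_display} {S : measurableType d}.
Variables (y : S -> nat -> TY).

Lemma measurable_beta : measurable_fun setT (beta r).
Proof.
have [mb _ _] := minorV.
apply: (measurable_comp (F := [set p : R * TY | 0 <= p.1])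
  (f := fun p => beta p.1 p.2) (g := pair r)) => //.
- rewrite [X in measurable X](_ : _ = fst @^-1` `[0, +oo[).
    by rewrite -[X in measurable X]setTI; exact: measurable_fst.
  by apply/seteqP; split => p /=; rewrite in_itv/= andbT.
- by move=> _ [e _ <-] /=; exact: ltW.
Qed.

Let mgamma : measurable_fun setT gamma. Proof. by have [_ []] := driftV. Qed.
Let mK : measurable_fun setT K. Proof. by have [_ _ []] := driftV. Qed.

(** Only the environment from [t - i] to [t] enters. With [S] carrying a sub-sigma-algebra, this
    yields the gap between a rate and the earlier blocks. *)
Lemma measurable_rate t :
  (forall k, (t - i <= k <= t)%N -> measurable_fun setT (fun w => y w k)) ->
  measurable_fun setT (fun w => rate gamma K beta r theta i (y w) t).
Proof.
move=> my; apply: measurable_funB => //; apply: measurable_funM; last first.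
  apply: measurable_maxr => //; apply: measurable_funB => //; apply: measurable_funM => //.
  by apply: measurable_load => // k /andP[k1 k2]; apply: my; rewrite k1 ltnW.
apply: measurable_funM => //.
rewrite (_ : (fun w => _) = (fun w => if beta r (y w t) <= 1 - theta then 1 else 0)); last first.
  by apply/funext => w; case: ifP.
apply: measurable_fun_ifT => //; apply: measurable_fun_ler => //.
apply: (measurableT_comp measurable_beta); apply: my.
by rewrite leqnn leq_subr.
Qed.

Lemma measurable_leak (v : S -> R) t : measurable_fun setT v ->
  (forall k, (k < t)%N -> measurable_fun setT (fun w => y w k)) ->
  measurable_fun setT (fun w => leak gamma K r theta i (v w) (y w) t).
Proof.
move=> mv my; apply: measurable_funM => //; apply: measurable_funD.
  by apply: measurable_funM => //; apply: measurable_growth => // k /andP[_]; exact: my.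
apply: measurable_funM => //; apply: (measurable_load mgamma mK (leq_subr i t)).
by move=> k /andP[_]; exact: my.
Qed.

Lemma measurable_uncoupled (v : S -> R) k : measurable_fun setT v ->
  (forall j, (j < k * L)%N -> measurable_fun setT (fun w => y w j)) ->
  measurable_fun setT (fun w => uncoupled gamma K beta r theta L i (v w) (y w) k).
Proof.
move=> mv; elim: k => [|k IH] my; first exact: measurable_cst.
have tk : (attempt_time L k < k.+1 * L)%N.
  by rewrite /attempt_time mulSn addnC ltn_add2r; case: L iL.
apply: measurable_minr => //; apply: measurable_funD; last first.
  by apply: measurable_leak => // j jt; apply: my; exact: ltn_trans tk.
apply: measurable_funM.
  by apply: measurable_rate => j /andP[_ jt]; apply: my; exact: leq_ltn_trans tk.
by apply: IH => j jk; apply: my; rewrite (leq_trans jk)// leq_mul2r leqnSn orbT.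
Qed.

End uncoupled_measurability.

Section uncoupled_expectation.
Context {dX dY : measure_display} {TX : measurableType dX} {TY : measurableType dY}
  {R : realType}.
Variable Q : R.-pker (TY * TX)%type ~> TX.
Variables (V : TX -> R) (gamma K : TY -> R) (beta : R -> TY -> R).
Hypotheses (driftV : drift Q V gamma K) (minorV : minorization Q V beta).
Variables (r theta : R) (L i : nat).
Hypotheses (r_gt0 : 0 < r) (theta_gt0 : 0 < theta) (theta_lt1 : theta < 1) (iL : (i < L)%N).
Context {d : measure_display} {S : measurableType d}.
Variable mu : {measure set S -> \bar R}.
Hypothesis mu1 : mu setT = 1%E.
Variables (y : S -> nat -> TY) (v : S -> R).
Hypotheses (my : forall k, measurable_fun setT (fun w => y w k))
  (mv : measurable_fun setT v) (v0 : forall w, 0 <= v w).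
Local Notation rho k w := (rate gamma K beta r theta i (y w) (attempt_time L k)).
Local Notation unc k w := (uncoupled gamma K beta r theta L i (v w) (y w) k).
Local Notation lk k w := (leak gamma K r theta i (v w) (y w) (attempt_time L k)).

Lemma unit_mfun_rate t : unit_mfun (fun w => rate gamma K beta r theta i (y w) t).
Proof.
split; first by apply: (measurable_rate driftV minorV) => // k _; exact: my.
by move=> w; exact: (rate_ge0 driftV).
Qed.

Lemma unit_mfun_uncoupled k : unit_mfun (fun w => unc k w).
Proof.
split; first by apply: (measurable_uncoupled driftV minorV) => // j _; exact: my.
by move=> w; exact: (uncoupled_unit driftV).
Qed.

(* [a] bounds the covariances, [C] the leaks: the two errors of each block are
   themselves contracted by the later blocks, hence the geometric series. *)
Lemma uncoupled_expectation (p a C : R) k : 0 <= p -> p < 1 -> 0 <= a -> 0 <= C ->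
  (forall k, \int[mu]_w rho k w <= p) ->
  (forall k, \int[mu]_w (unc k w * rho k w) <=
     (\int[mu]_w unc k w) * \int[mu]_w rho k w + a) ->
  (forall k, \int[mu]_w Num.min 1 (lk k w) <= C) ->
  \int[mu]_w unc k w <= p ^+ k + (a + C) / (1 - p).
Proof.
move=> p0 p1 a0 C0 rhop cov lkC.
have q0 : 0 < 1 - p by rewrite subr_gt0.
elim: k => [|k IH].
  rewrite (_ : (fun w => _) = fun=> 1)// (Exp_cst mu1) expr0 lerDl; apply: divr_ge0; [exact: addr_ge0|exact: ltW].
have um k' := unit_bounded_mfun (unit_mfun_uncoupled k').
have ur k' := unit_bounded_mfun (unit_mfun_rate (attempt_time L k')).
have ul : bounded_mfun (fun w => Num.min 1 (lk k w)).
  apply/unit_bounded_mfun/unit_mfun_min1.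
    by apply: (measurable_leak driftV) => // j _; exact: my.
  by move=> w; apply: (leak_ge0 driftV).
have bur : bounded_mfun (fun w => unc k w * rho k w) by exact: bounded_mfunM.
apply: (@le_trans _ _ (\int[mu]_w (unc k w * rho k w + Num.min 1 (lk k w)))).
  apply: le_Exp => //; first exact: bounded_mfunD.
  move=> w; rewrite uncoupledS mulrC.
  have l0 : 0 <= lk k w by apply: (leak_ge0 driftV).
  have /andP[u0 _] := (unit_mfun_uncoupled k).2 w.
  have /andP[r0 _] := (unit_mfun_rate (attempt_time L k)).2 w.
  have ur0 := mulr_ge0 u0 r0.
  by case: (leP 1 (lk k w)) => ?; rewrite ge_min; [rewrite lerDr ur0|rewrite lexx orbT].
rewrite (ExpD mu1 bur ul).
have /andP[U0 U1] := Exp_unit mu1 (unit_mfun_uncoupled k).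
have H1 := cov k; have H2 := lkC k.
have H3 : (\int[mu]_w unc k w) * \int[mu]_w rho k w <=
    (p ^+ k + (a + C) / (1 - p)) * p.
  apply: ler_pM => //.
  by apply: Exp_ge0 => w; case/andP: ((unit_mfun_rate (attempt_time L k)).2 w).
(* [(a + C) / (1 - p)] is the fixed point of the affine recursion with slope [p] and constant
   [a + C]. *)
have E : (a + C) / (1 - p) = a + C + (a + C) / (1 - p) * p.
  by field; rewrite gt_eqF.
rewrite E exprSr; rewrite mulrDl in H3; lra.
Qed.

End uncoupled_expectation.

(** * Forgetting in mean *)

Section forgetting.
Context {d dX dY : measure_display} {Omega : measurableType d}
  {TX : measurableType dX} {TY : measurableType dY} {R : realType}.
Variable P : probability Omega R.
Variables (X : int -> {RV P >-> TX}) (Y : int -> {RV P >-> TY}).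
Variable Q : R.-pker (TY * TX)%type ~> TX.
Variables (V : TX -> R) (gamma K : TY -> R) (beta : R -> TY -> R).
Hypotheses (statY : stationary Y) (hA : assumptionA Q V gamma K beta Y)
  (mcre : MCRE Q X Y) (statXY : stationary (joint X Y)).

Let P1 : P setT = 1%E := probability_setT P.
Let driftV : drift Q V gamma K := A_drift hA.
Let minorV : minorization Q V beta := A_minorization hA.
Let mV : measurable_fun setT V. Proof. by have [[]] := driftV. Qed.
Let V0 : forall x, 0 <= V x. Proof. by have [[]] := driftV. Qed.
Let mgamma : measurable_fun setT gamma. Proof. by have [_ []] := driftV. Qed.
Let gamma0 : forall e, 0 < gamma e. Proof. by have [_ []] := driftV. Qed.
Let mK : measurable_fun setT K. Proof. by have [_ _ []] := driftV. Qed.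
Let K0 : forall e, 0 < K e. Proof. by have [_ _ []] := driftV. Qed.
Let mXV s : measurable_fun setT (fun w => V (X s w)).
Proof. by apply: measurableT_comp => //; exact: measurable_funPT. Qed.
Let menv s k : measurable_fun setT (fun w => env Y s w k).
Proof. exact: measurable_env. Qed.

Definition tail i : R := fine (r_coef gamma K Y i).

Lemma tailE i : (tail i)%:E = r_coef gamma K Y i.
Proof.
rewrite /tail fineK// ge0_fin_numE; last exact: r_coef_ge0.
apply: (@le_lt_trans _ _ (r_coef gamma K Y 0)); last by have [] := A1 hA.
exact: r_coef_le.
Qed.

Lemma tail_ge0 i : 0 <= tail i.
Proof. by rewrite -lee_fin tailE; exact: r_coef_ge0. Qed.

Lemma tail_le i j : (i <= j)%N -> tail j <= tail i.
Proof. by move=> ij; rewrite -lee_fin !tailE; exact: r_coef_le. Qed.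

Lemma tail_cvg0 (e : R) : 0 < e -> exists n, forall i, (n <= i)%N -> tail i <= e.
Proof.
move=> e0.
have : (r_coef gamma K Y N @[N --> \oo] --> 0%:E)%E.
  apply: nneseries_tail_cvg; first by have [] := A1 hA.
  by move=> k _; exact: d_coef_ge0.
move=> /fine_cvgP[_] /cvgrPdist_le /(_ _ e0) [n _ nP]; exists n => i ni.
by have := nP i ni; rewrite /= sub0r normrN ger0_norm// tail_ge0.
Qed.

(** By stationarity of the joint process all [V (X s)] have one law, and a single real random
    variable is tight. *)
Lemma V_tight (e : R) : 0 < e ->
  exists2 M : R, 0 <= M & forall s, fine (P [set w | M < V (X s w)]) <= e.
Proof.
move=> e0.
have mF s (M : R) : measurable [set w | M < V (X s w)].
  exact: strict_superlevel_measurable.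
have stV s M : P [set w | M < V (X s w)] = P [set w | M < V (X 0 w)].
  pose A := [set x : 1.-tuple (TX * TY) | M < V (tnth x ord0).1].
  have mA : measurable A.
    apply: (strict_superlevel_measurable (f := fun x : 1.-tuple (TX * TY) => V (tnth x ord0).1)).
    apply: (measurableT_comp mV); apply: (measurableT_comp measurable_fst).
    exact: measurable_tnth.
  have := statXY (fun=> 0) s mA; rewrite /pushforward.
  rewrite (_ : _ @^-1` A = [set w | M < V (X s w)]); last first.
    by apply/seteqP; split => w; rewrite /A /= tnth_mktuple add0r.
  move=> ->; congr (P _).
  by apply/seteqP; split => w; rewrite /A /= tnth_mktuple.
pose F n := [set w | n%:R < V (X 0 w)].
have : (P \o F) n @[n --> \oo] --> P (\bigcap_n F n).
  apply: nonincreasing_cvg_mu => //.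
  - by apply: (@le_lt_trans _ _ 1%E); [apply: probability_le1; exact: mF|exact: ltry].
  - by move=> n; exact: mF.
  - by apply: bigcapT_measurable => n; exact: mF.
  - move=> m n mn; apply/subsetPset => w; rewrite /F/=; apply: le_lt_trans.
    by rewrite ler_nat.
rewrite (_ : \bigcap_n F n = set0); last first.
  apply/seteqP; split => w // /(_ (Num.truncn (V (X 0 w))).+1 Logic.I).
  rewrite /F/= => /ltW; rewrite leNgt.
  by have /andP[_ ->] := Num.Theory.truncn_itv (V0 (X 0 w)).
rewrite measure0 => /fine_cvgP[_] /cvgrPdist_le /(_ _ e0) [n _ nP].
exists n%:R => // s; rewrite stV.
have := nP n (leqnn n); rewrite /= sub0r normrN ger0_norm//.
by rewrite fine_ge0.
Qed.

Let bmin (f : Omega -> R) : measurable_fun setT f -> (forall w, 0 <= f w) ->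
  bounded_mfun (fun w => Num.min 1 (f w)).
Proof. by move=> mf f0; apply/unit_bounded_mfun/unit_mfun_min1. Qed.

Lemma min1D (a b : R) : 0 <= a -> 0 <= b ->
  Num.min 1 (a + b) <= Num.min 1 a + Num.min 1 b.
Proof.
move=> a0 b0; rewrite ge_min; have [a1|a1] := leP 1 a.
  by rewrite lerDl le_min ler01 b0.
have [b1|b1] := leP 1 b; first by rewrite lerDr a0.
by rewrite lexx orbT.
Qed.

Lemma Exp_min1Z (u : R) (f : Omega -> R) i : 0 <= u -> measurable_fun setT f ->
  (forall w, 0 <= f w) -> (\int[P]_w (f w)%:E <= r_coef gamma K Y i)%E ->
  \int[P]_w Num.min 1 (u * f w) <= u * tail i.
Proof.
move=> u0 mf f0 fr; rewrite -lee_fin; apply: Exp_min1_le => //.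
- exact: measurable_funM.
- by move=> w; rewrite mulr_ge0.
under eq_integral do rewrite EFinM.
rewrite ge0_integralZl//; [|exact/measurable_EFinP|by move=> w _; rewrite lee_fin].
by rewrite EFinM tailE lee_wpmul2l.
Qed.

(* Going back [m] steps, the drift turns [V (X s)] into a load, of mean at most
   [tail l], and a multiple of [V (X (s - m))], which is small for large [m]
   since [V (X s)] is tight uniformly in [s]. *)
Lemma V_growth (u : R) s l : 0 <= u -> (0 < l)%N ->
  \int[P]_w Num.min 1 (u * (V (X s w) * growth gamma (env Y s w) 0 l)) <= u * tail l.
Proof.
move=> u0 l0; apply/ler_addgt0Pr => e e0.
have e2 : 0 < e / 2 by rewrite divr_gt0.
have [M M0 VM] := V_tight e2.
(* The added 1 keeps the divisor positive when [u * M] vanishes. *)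
have uM : 0 < u * M + 1 by rewrite ltr_wpDl// mulr_ge0.
have [m mP] := tail_cvg0 (divr_gt0 e2 uM).
pose s' := s - m%:Z.
have s'E : s' + m%:Z = s by rewrite /s' subrK.
pose OY := g_sigma_algebraType (history X Y set0 setT).
pose f (p : OY * TX) : R := Num.min 1 (u * growth gamma (env Y s p.1) 0 l * V p.2).
have uf : unit_mfun f.
  apply: unit_mfun_min1; last first.
    by move=> p; rewrite mulr_ge0// mulr_ge0// growth_ge0.
  apply: measurable_funM; last exact: measurableT_comp.
  apply: measurable_funM => //.
  apply: (measurableT_comp (f := fun w : OY => growth gamma (env Y s w) 0 l)) => //.
  by apply: measurable_growth => // k _; exact: historyY.
have GT : <<s history X Y (upto s') setT >> setT.
  exact: (@measurableT _ (g_sigma_algebraType (history X Y (upto s') setT))).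
have := MCRE_iter mcre m GT uf; rewrite s'E => step.
have -> : \int[P]_w Num.min 1 (u * (V (X s w) * growth gamma (env Y s w) 0 l)) =
    \int[P]_w (\1_[set: Omega] w * f (w, X s w)).
  apply: eq_Rintegral => w _; rewrite indicT mul1r /f/=.
  by congr (Num.min 1 _); rewrite mulrAC mulrA.
rewrite step.
pose A w := u * (growth gamma (env Y s' w) 0 (m + l) * V (X s' w)).
pose B w := u * load gamma K (env Y s' w) 0 m (m + l).
have mG n : measurable_fun setT (fun w => growth gamma (env Y s' w) 0 n).
  by apply: measurable_growth => // k _; exact: menv.
have mA : measurable_fun setT A.
  by apply: measurable_funM => //; apply: measurable_funM.
have mld : measurable_fun setT (fun w => load gamma K (env Y s' w) 0 m (m + l)).
  by apply: (measurable_load mgamma mK (leq_addr l m)) => k _; exact: menv.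
have mB : measurable_fun setT B by exact: measurable_funM.
have A0 w : 0 <= A w by rewrite mulr_ge0// mulr_ge0// growth_ge0.
have B0 w : 0 <= B w by rewrite mulr_ge0// load_ge0.
have pointwise w : enviter Q (fun k => Y (s' + k%:Z) w) m (fun z => f (w, z)) (X s' w) <=
    Num.min 1 (A w) + Num.min 1 (B w).
  apply: le_trans (min1D (A0 w) (B0 w)); rewrite le_min.
  have ufw : unit_mfun (fun z => f (w, z)).
    split; first by apply: measurableT_comp uf.1 _; exact: pair1_measurable.
    by move=> z; exact: uf.2.
  have [_ /(_ (X s' w)) /andP[_ ->]] := unit_mfun_enviter Q (fun k => Y (s' + k%:Z) w) m ufw.
  pose G := growth gamma (env Y s w) 0 l.
  have uG0 : 0 <= u * G by rewrite mulr_ge0// growth_ge0.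
  have fV z : f (w, z) <= u * G * V z + 0 by rewrite addr0 /f ge_min lexx orbT.
  apply: (le_trans (enviter_drift driftV _ _ _ ufw uG0 (lexx 0) fV)).
  have GE : G = growth gamma (env Y s' w) m (m + l).
    by rewrite -[X in growth _ _ X _]addn0 growth_shift env_shift s'E.
  rewrite addr0 /A /B -(growth_cat gamma _ (leq0n m) (leq_addr l m)).
  rewrite -(load_growth gamma K _ _ (leq_addr l m)) -GE -/(env Y s' w).
  by rewrite le_eqVlt; apply/orP; left; apply/eqP; ring.
have bAB : bounded_mfun (fun w => Num.min 1 (A w) + Num.min 1 (B w)).
  by apply: bounded_mfunD; exact: bmin.
have benv : bounded_mfun (fun w => enviter Q (fun k => Y (s' + k%:Z) w) m
    (fun z => f (w, z)) (X s' w)).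
  have := @unit_mfun_enviter_joint _ _ _ _ _ Q _ OY (fun k => Y (s' + k%:Z)) m _ _ uf.
  move=> /(_ _)/unit_bounded_mfun/(bounded_mfun_comp
    (@measurable_history_pair _ _ _ _ _ _ _ P X Y setT s')); apply.
  by move=> k _; exact: historyY.
apply: (@le_trans _ _ (\int[P]_w (Num.min 1 (A w) + Num.min 1 (B w)))).
  rewrite (_ : \int[P]_w _ = \int[P]_w enviter Q (fun k => Y (s' + k%:Z) w) m
    (fun z => f (w, z)) (X s' w)); last first.
    by apply: eq_Rintegral => w _; rewrite indicT mul1r.
  exact: le_Exp.
rewrite (ExpD P1); [|exact: bmin..].
rewrite addrC; apply: lerD.
  apply: Exp_min1Z => //; first by move=> w; exact: load_ge0.
  have := @load_moment _ _ _ _ _ P Y gamma K statY mgamma mK gamma0 K0 s' 0 m (m + l).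
  by rewrite addKn; apply; rewrite leq0n leq_addr.
(* On [D] the truncation at 1 costs the probability of [D]; off [D], [V (X s')] is at most [M] and
   the mean of a product of [m + l] factors [gamma] remains, small by the choice of [m]. *)
pose D := [set w | M < V (X s' w)].
have mD : measurable D by exact: strict_superlevel_measurable.
have b1D : bounded_mfun (\1_D : Omega -> R) by exact/unit_bounded_mfun/unit_mfun_indic.
have bG : bounded_mfun (fun w => Num.min 1 (u * M * growth gamma (env Y s' w) 0 (m + l))).
  apply: bmin; first exact: measurable_funM.
  by move=> w; rewrite !mulr_ge0// growth_ge0.
apply: (@le_trans _ _ (\int[P]_w (\1_D w +
    Num.min 1 (u * M * growth gamma (env Y s' w) 0 (m + l))))).
  apply: le_Exp => //; [exact: bmin|exact: bounded_mfunD|move=> w].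
  have G0 : 0 <= growth gamma (env Y s' w) 0 (m + l) by exact: growth_ge0.
  have uMG : 0 <= u * M * growth gamma (env Y s' w) 0 (m + l) by rewrite !mulr_ge0.
  have [Dw|Dw] := ltP M (V (X s' w)).
    rewrite indicE mem_set// ge_min; apply/orP; left.
    by rewrite lerDl le_min ler01 uMG.
  rewrite indicE memNset ?add0r; last by rewrite /D/=; apply/negP; rewrite -leNgt.
  rewrite le_min ge_min lexx/= ge_min; apply/orP; right.
  by rewrite /A -mulrA ler_wpM2l// mulrC ler_wpM2r.
rewrite (ExpD P1 b1D bG) Exp_indic//.
have -> : e = e / 2 + e / 2 by field.
apply: lerD; first exact: VM.
apply: (@le_trans _ _ (u * M * tail (m + l))).
  apply: Exp_min1Z => //; first exact: mulr_ge0.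
    by move=> w; exact: growth_ge0.
  apply: le_trans (d_coef_le_r_coef statY mgamma mK gamma0 K0 (leqnn _)).
  by apply: growth_moment => //; rewrite addn_gt0 l0 orbT.
have := mP (m + l)%N (leq_addr _ _).
rewrite ler_pdivlMr// => H; have T0 := tail_ge0 (m + l); lra.
Qed.

Variables (r theta : R).
Hypotheses (r_gt0 : 0 < r) (theta_gt0 : 0 < theta) (theta_lt1 : theta < 1).
Hypothesis r_large : 8 * tail 0 <= r.
Hypothesis theta_good : forall t : int,
  fine (P [set w | 1 - theta < beta r (Y t w)]) <= 1 / 4.

(** An attempt fails because of [beta] with probability at most 1/4, and the load costs in mean
    [2 / r * tail 0], at most 1/4 by [r_large]: half of [theta] survives. *)
Lemma rate_expectation i s t :
  \int[P]_w rate gamma K beta r theta i (env Y s w) t <= 1 - theta / 2.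
Proof.
have [th0 th1 rr0] := And3 theta_gt0 theta_lt1 r_gt0.
pose D := [set w | 1 - theta < beta r (env Y s w t)].
have mD : measurable D.
  apply: strict_superlevel_measurable.
  by apply: (measurableT_comp (measurable_beta minorV r_gt0)); exact: menv.
pose Z w := load gamma K (env Y s w) (t - i) t t.
have mZ : measurable_fun setT Z.
  by apply: (measurable_load mgamma mK (leqnn t)) => k _; exact: menv.
have Z0 w : 0 <= Z w by exact: load_ge0.
have r2 : 0 <= 2 / r by rewrite divr_ge0// ltW.
have bZ : bounded_mfun (fun w => Num.min 1 (2 / r * Z w)).
  by apply: bmin; [exact: measurable_funM|move=> w; exact: mulr_ge0].
have bD : bounded_mfun (\1_D : Omega -> R) by exact/unit_bounded_mfun/unit_mfun_indic.
have bDZ := bounded_mfunD bD bZ.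
apply: (@le_trans _ _ (\int[P]_w (1 - theta + theta * (\1_D w + Num.min 1 (2 / r * Z w))))).
  apply: le_Exp => //.
  - exact/unit_bounded_mfun/(unit_mfun_rate driftV minorV).
  - by apply: bounded_mfunD; [exact: bounded_mfun_cst|exact: bounded_mfunZ].
  move=> w; rewrite /rate -/(Z w).
  have m0 : 0 <= Num.min 1 (2 / r * Z w) by rewrite le_min ler01 mulr_ge0.
  have [bw|bw] := leP (beta r (env Y s w t)) (1 - theta).
    have -> : \1_D w = 0 :> R.
      by rewrite indicE memNset//= => /(le_lt_trans bw); rewrite ltxx.
    rewrite mulr1 add0r.
    have [?|?] := leP 1 (2 / r * Z w).
      by rewrite max_l; lra.
    by rewrite max_r; lra.
  have -> : \1_D w = 1 :> R by rewrite indicE mem_set.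
  rewrite mulr0 mul0r subr0; nra.
rewrite (ExpD P1 (bounded_mfun_cst _)) ?(ExpZ P1 _ bDZ) ?(ExpD P1 bD bZ); last exact: bounded_mfunZ.
rewrite Exp_cst// Exp_indic//.
have H1 : fine (P D) <= 1 / 4 by exact: theta_good.
have H2 : \int[P]_w Num.min 1 (2 / r * Z w) <= 2 / r * tail 0.
  apply: Exp_min1Z => //.
  have := @load_moment _ _ _ _ _ P Y gamma K statY mgamma mK gamma0 K0 s (t - i) t t.
  by rewrite subnn; apply; rewrite leq_subr leqnn.
have H3 : 2 / r * tail 0 <= 1 / 4.
  by rewrite mulrAC ler_pdivrMr//; move: r_large; lra.
nra.
Qed.

(* Block lengths are [q + 1], which leaves a gap of [q - i] between the
   environment used by the first [k] blocks and by the attempt in the next one. *)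
Lemma uncoupled_bound (J : int -> set int) (v : Omega -> R) (C : R) s i q k :
  (0 < i)%N -> (i <= q)%N -> 0 <= C ->
  (forall w, 0 <= v w) ->
  (forall t, (s <= t)%R -> measurable_fun setT
    (v : g_sigma_algebraType (history X Y (J t) (upto t)) -> R)) ->
  (forall t A F, <<s history X Y (J t) (upto t) >> A ->
     <<s history X Y set0 (from (t + (q - i)%N%:Z)) >> F ->
     `|fine (P (A `&` F)) - fine (P A) * fine (P F)| <= fine (alpha_coef Y (q - i))) ->
  (forall l, (i <= l)%N ->
    \int[P]_w Num.min 1 (theta / r * (v w * growth gamma (env Y s w) 0 l)) <= C * tail i) ->
  \int[P]_w uncoupled gamma K beta r theta q.+1 i (v w) (env Y s w) k <=
    (1 - theta / 2) ^+ k +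
    (fine (alpha_coef Y (q - i)) + (C + 2 / r) * tail i) / (theta / 2).
Proof.
move=> i0 iq C0 v0 mv cov vC.
have [th0 th1 rr0] := And3 theta_gt0 theta_lt1 r_gt0.
have mv' : measurable_fun setT v.
  exact: (measurableT_comp (mv s (lexx _)) (@measurable_history _ _ _ _ _ _ _ P X Y (J s) (upto s))).
have iL : (i < q.+1)%N by [].
have p0 : 0 <= 1 - theta / 2 by lra.
have p1 : 1 - theta / 2 < 1 by lra.
have a0 : 0 <= fine (alpha_coef Y (q - i)) by rewrite fine_ge0// alpha_coef_ge0.
have CC0 : 0 <= (C + 2 / r) * tail i.
  by rewrite mulr_ge0 ?tail_ge0// addr_ge0// divr_ge0// ltW.
have := uncoupled_expectation driftV minorV r_gt0 theta_gt0 theta_lt1 iL P1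
  (y := env Y s) (v := v) (menv s) mv' v0 k p0 p1 a0 CC0.
rewrite subKr; apply.
- by move=> k'; exact: rate_expectation.
- move=> k'; set t := attempt_time q.+1 k'.
  (* The first [k'] blocks end at [t'] and read the environment before it, whereas the next rate
     reads it from [t' + (q - i)] on. *)
  pose t' := s + (k' * q.+1)%N%:Z.
  have tE : t = (k' * q.+1 + q)%N by [].
  have uu : unit_mfun (fun w => uncoupled gamma K beta r theta q.+1 i (v w) (env Y s w) k' : R)
      (T := g_sigma_algebraType (history X Y (J t') (upto t'))).
    split; last by move=> w; exact: (uncoupled_unit driftV).
    apply: (@measurable_uncoupled _ _ _ _ _ _ _ _ _ _ driftV minorV _ theta _ _ r_gt0 iL
      _ (g_sigma_algebraType (history X Y (J t') (upto t'))) (env Y s) v k').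
      by apply: mv; rewrite /t' lerDl.
    move=> j jk; apply: historyY; rewrite /upto/= /t' lerD2l lez_nat.
    exact: ltnW.
  have ur : unit_mfun (fun w => rate gamma K beta r theta i (env Y s w) t : R)
      (T := g_sigma_algebraType (history X Y set0 (from (t' + (q - i)%N%:Z)))).
    split; last by move=> w; exact: (rate_ge0 driftV).
    apply: (@measurable_rate _ _ _ _ _ _ _ _ _ _ driftV minorV _ theta i r_gt0
      _ (g_sigma_algebraType (history X Y set0 (from (t' + (q - i)%N%:Z)))) (env Y s)).
    move=> j /andP[jt _]; apply: historyY; rewrite /from/= /t' -addrA lerD2l -PoszD lez_nat.
    by rewrite (leq_trans _ jt)// tE addnBA.
  have := covariance_functions (@history_measurable _ _ _ _ _ _ _ P X Y (J t') (upto t'))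
    (@history_measurable _ _ _ _ _ _ _ P X Y set0 (from (t' + (q - i)%N%:Z)))
    (cov t') uu ur.
  by rewrite ler_norml => /andP[_]; rewrite lerBlDl.
- move=> k'; set t := attempt_time q.+1 k'.
  have it : (i <= t)%N by rewrite /t /attempt_time (leq_trans iq)// leq_addl.
  pose A w := theta / r * (v w * growth gamma (env Y s w) 0 t).
  pose B w := 2 * theta / r * load gamma K (env Y s w) 0 (t - i) t.
  have thr : 0 <= theta / r by rewrite divr_ge0// ltW.
  have thr2 : 0 <= 2 * theta / r by rewrite divr_ge0 ?mulr_ge0// ltW.
  have A0 w : 0 <= A w by rewrite mulr_ge0// mulr_ge0// growth_ge0.
  have B0 w : 0 <= B w by rewrite mulr_ge0// load_ge0.
  have mld : measurable_fun setT (fun w => load gamma K (env Y s w) 0 (t - i) t).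
    by apply: (measurable_load mgamma mK (leq_subr i t)) => j _; exact: menv.
  have mA : measurable_fun setT A.
    apply: measurable_funM => //; apply: measurable_funM => //.
    by apply: measurable_growth => // j _; exact: menv.
  have mB : measurable_fun setT B by exact: measurable_funM.
  apply: (@le_trans _ _ (\int[P]_w (Num.min 1 (A w) + Num.min 1 (B w)))).
    apply: le_Exp => //.
    - apply: bmin; first by apply: (measurable_leak driftV) => // j _; exact: menv.
      by move=> w; apply: (leak_ge0 driftV).
    - by apply: bounded_mfunD; exact: bmin.
    move=> w; apply: le_trans (min1D (A0 w) (B0 w)).
    have -> // : leak gamma K r theta i (v w) (env Y s w) t = A w + B w.
    by rewrite /leak /A /B; ring.
  rewrite (ExpD P1); [|exact: bmin..].
  rewrite mulrDl; apply: lerD; first exact: vC.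
  apply: (@le_trans _ _ (2 * theta / r * tail i)).
    apply: Exp_min1Z => //; first by move=> w; exact: load_ge0.
    have := @load_moment _ _ _ _ _ P Y gamma K statY mgamma mK gamma0 K0 s 0 (t - i) t.
    by rewrite subKn//; apply; rewrite leq0n leq_subr.
  rewrite ler_wpM2r ?tail_ge0// ler_pM2r ?invr_gt0//; lra.
Qed.

(** First pass: from a constant start [uncoupled] is a function of the environment alone, so [J] is
    empty and the covariances are those of [Y], with no information on [X]. *)
Lemma constant_uncoupled (c : R) s i q k : (0 < i)%N -> (i <= q)%N -> 0 <= c ->
  \int[P]_w uncoupled gamma K beta r theta q.+1 i c (env Y s w) k <=
    (1 - theta / 2) ^+ k +
    (fine (alpha_coef Y (q - i)) + (c / r + 2 / r) * tail i) / (theta / 2).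
Proof.
move=> i0 iq c0; have [th0 th1 rr0] := And3 theta_gt0 theta_lt1 r_gt0.
apply: (uncoupled_bound (J := fun=> set0) (v := fun=> c)) => //.
- by rewrite divr_ge0// ltW.
- by move=> t A F; exact: environment_covariance.
move=> l il.
have thr : 0 <= theta / r by rewrite divr_ge0// ltW.
apply: (@le_trans _ _ (theta / r * c * tail i)).
  under eq_Rintegral do rewrite mulrA.
  apply: Exp_min1Z => //.
  - by rewrite mulr_ge0.
  - by apply: measurable_growth => // j _; exact: menv.
  - by move=> w; exact: growth_ge0.
  apply: le_trans (d_coef_le_r_coef statY mgamma mK gamma0 K0 il).
  by apply: growth_moment => //; exact: leq_trans il.
rewrite ler_wpM2r ?tail_ge0// mulrAC ler_pM2r ?invr_gt0//; nra.
Qed.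

Hypothesis mixY : alpha_mixing Y.

Lemma alpha_cvg0 (e : R) : 0 < e -> exists n, fine (alpha_coef Y n) <= e.
Proof.
move=> e0; have : (alpha_coef Y N @[N --> \oo] --> 0%:E)%E by exact: mixY.
move=> /fine_cvgP[_] /cvgrPdist_le /(_ _ e0) [n _ nP]; exists n.
have := nP n (leqnn n); rewrite /= sub0r normrN ger0_norm//.
by rewrite fine_ge0// alpha_coef_ge0.
Qed.

Lemma geometric_cvg0 (e p : R) : 0 < e -> 0 <= p < 1 -> exists k, p ^+ k <= e.
Proof.
move=> e0 /andP[p0 p1].
have : p ^+ n @[n --> \oo] --> (0 : R) by apply: cvg_expr; rewrite ger0_norm.
move=> /cvgrPdist_le /(_ _ e0) [n _ nP]; exists n.
by have := nP n (leqnn n); rewrite /= sub0r normrN ger0_norm ?exprn_ge0.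
Qed.

Lemma enviter_uncoupled_norm x x' y q i k h : (i <= q)%N -> unit_mfun h ->
  `|enviter Q y (k * q.+1) h x - enviter Q y (k * q.+1) h x'| <=
    uncoupled gamma K beta r theta q.+1 i (V x + V x') y k.
Proof.
move=> iq uh; have iL : (i < q.+1)%N by [].
have E a b := enviter_uncoupled driftV minorV r_gt0 theta_gt0 theta_lt1 iL a b y k uh.
have := E x x'; have := E x' x; rewrite (addrC (V x') (V x)).
by rewrite ler_norml => ? ?; apply/andP; split; lra.
Qed.

Lemma unit_mfun_chain (J : set int) s n
    (f : g_sigma_algebraType (history X Y set0 J) * TX -> R) (x : Omega -> TX) :
  (forall k, (k < n)%N -> J (s + k%:Z)) -> measurable_fun setT x -> unit_mfun f ->
  unit_mfun (fun w : Omega => enviter Q (env Y s w) n (fun z => f (w, z)) (x w)).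
Proof.
move=> Jn mx uf.
have my k : (k < n)%N -> measurable_fun setT
    (Y (s + k%:Z) : g_sigma_algebraType (history X Y set0 J) -> TY).
  by move=> kn; apply: historyY; exact: Jn.
have mp : measurable_fun setT
    (fun w => (w, x w) : g_sigma_algebraType (history X Y set0 J) * TX).
  by apply: measurable_fun_pair => //; exact: measurable_history.
exact: (unit_mfun_comp mp (unit_mfun_enviter_joint Q my uf)).
Qed.

(** By tightness [V (X s)] is replaced by a constant off an event of small probability, uniformly in
    [s]; monotonicity of [uncoupled] in its start then reduces to the first pass. *)
Lemma environment_forgets (e : R) : 0 < e -> exists x0 n, forall s
    (f : g_sigma_algebraType (history X Y set0 setT) * TX -> R), unit_mfun f ->
  \int[P]_w `|enviter Q (fun k => Y (s + k%:Z) w) n (fun z => f (w, z)) (X s w) -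
              enviter Q (fun k => Y (s + k%:Z) w) n (fun z => f (w, z)) x0| <= e.
Proof.
move=> e0; have [th0 th1 rr0] := And3 theta_gt0 theta_lt1 r_gt0.
pose x0 : TX := point; exists x0.
have e4 : 0 < e / 4 by rewrite divr_gt0.
have [M M0 VM] := V_tight e4.
pose c := M + V x0; have c0 : 0 <= c by rewrite addr_ge0.
(* Tightness, the geometric term, the mixing coefficient and the tail get [e / 4] each; the last two
   carry a factor [theta / 2] because the bound divides them by it. *)
have et : 0 < e / 4 * (theta / 2) by rewrite !mulr_gt0// ?invr_gt0//; lra.
have cr : 0 < c / r + 2 / r by rewrite -mulrDl divr_gt0//; lra.
have [i iP] := tail_cvg0 (divr_gt0 et cr).
have [a aP] := alpha_cvg0 et.
have [k kP] := @geometric_cvg0 (e / 4) (1 - theta / 2) e4 ltac:(lra).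
(* The look-back length must be positive, hence [i.+1]; [q] exceeds it by exactly the gap [a]. *)
pose q := (i.+1 + a)%N; exists (k * q.+1)%N => s f uf.
have iq : (i.+1 <= q)%N by exact: leq_addr.
have aE : (q - i.+1 = a)%N by rewrite addKn.
have := constant_uncoupled s k (ltn0Sn i) iq c0; rewrite aE.
move=> Uk.
pose D := [set w | M < V (X s w)].
have mD : measurable D by exact: strict_superlevel_measurable.
have b1D : bounded_mfun (\1_D : Omega -> R) by exact/unit_bounded_mfun/unit_mfun_indic.
have iL : (i.+1 < q.+1)%N by [].
have bU : bounded_mfun (fun w => uncoupled gamma K beta r theta q.+1 i.+1 c (env Y s w) k).
  apply/unit_bounded_mfun.
  exact: (unit_mfun_uncoupled driftV minorV r_gt0 theta_gt0 theta_lt1 iL (v := fun=> c)).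
have bg x : measurable_fun setT x -> bounded_mfun (fun w : Omega =>
    enviter Q (env Y s w) (k * q.+1) (fun z => f (w, z)) (x w)).
  by move=> mx; apply: unit_bounded_mfun; exact: (unit_mfun_chain (J := setT)).
apply: (@le_trans _ _ (\int[P]_w (\1_D w +
    uncoupled gamma K beta r theta q.+1 i.+1 c (env Y s w) k))).
  apply: le_Exp => //.
  - by apply/bounded_mfun_norm/bounded_mfunB; apply: bg => //; exact: measurable_funPT.
  - exact: bounded_mfunD.
  move=> w; have ufw : unit_mfun (fun z => f (w, z)).
    split; first by apply: measurableT_comp uf.1 _; exact: pair1_measurable.
    by move=> z; exact: uf.2.
  apply: (le_trans (enviter_uncoupled_norm (X s w) x0 (env Y s w) k iq ufw)).
  have vx0 : 0 <= V (X s w) + V x0 by rewrite addr_ge0.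
  have [Dw|Dw] := ltP M (V (X s w)).
    rewrite indicE mem_set//.
    have /andP[_ u1] := uncoupled_unit driftV beta q.+1 i.+1 r_gt0 theta_gt0 theta_lt1 (env Y s w) k vx0.
    have /andP[u0 _] := uncoupled_unit driftV beta q.+1 i.+1 r_gt0 theta_gt0 theta_lt1 (env Y s w) k c0.
    by rewrite (le_trans u1)// lerDl.
  rewrite indicE memNset ?add0r; last by rewrite /D/=; apply/negP; rewrite -leNgt.
  by apply: (le_uncoupled driftV) => //; rewrite vx0 lerD2r.
rewrite (ExpD P1 b1D bU) Exp_indic//.
have H1 := VM s; have H2 := iP _ (leqnSn i); rewrite ler_pdivlMr// in H2.
have H3 : (fine (alpha_coef Y a) + (c / r + 2 / r) * tail i.+1) / (theta / 2) <= e / 2.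
  rewrite ler_pdivrMr; last by rewrite divr_gt0.
  rewrite mulrC in H2; lra.
lra.
Qed.

(** Second pass: the start depends on the past of the chain, so the covariances come from causality,
    available now that forgetting is known. In [(1 + c) / r] the 1 is due to [V_growth] and [c] to
    [growth_moment]. *)
Lemma chain_uncoupled (c : R) s i q k : (0 < i)%N -> (i <= q)%N -> 0 <= c ->
  \int[P]_w uncoupled gamma K beta r theta q.+1 i (V (X s w) + c) (env Y s w) k <=
    (1 - theta / 2) ^+ k +
    (fine (alpha_coef Y (q - i)) + ((1 + c) / r + 2 / r) * tail i) / (theta / 2).
Proof.
move=> i0 iq c0; have [th0 th1 rr0] := And3 theta_gt0 theta_lt1 r_gt0.
apply: (uncoupled_bound (J := upto) (v := fun w => V (X s w) + c)) => //.
- by rewrite divr_ge0 ?addr_ge0// ltW.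
- by move=> w; rewrite addr_ge0.
- move=> t st; apply: measurable_funD => //; apply: (measurableT_comp mV).
  exact: historyX.
- by move=> t A F; apply: (causal_covariance mcre); exact: environment_forgets.
move=> l il; have l0 : (0 < l)%N by exact: leq_trans il.
have thr : 0 <= theta / r by rewrite divr_ge0// ltW.
have mG : measurable_fun setT (fun w => growth gamma (env Y s w) 0 l).
  by apply: measurable_growth => // j _; exact: menv.
have G0 w : 0 <= growth gamma (env Y s w) 0 l by exact: growth_ge0.
pose A w := theta / r * (V (X s w) * growth gamma (env Y s w) 0 l).
pose B w := theta / r * c * growth gamma (env Y s w) 0 l.
have A0 w : 0 <= A w by apply: mulr_ge0 => //; exact: mulr_ge0.
have B0 w : 0 <= B w by apply: mulr_ge0 => //; exact: mulr_ge0.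
have bA : bounded_mfun (fun w => Num.min 1 (A w)).
  by apply: bmin => // ; apply: measurable_funM => //; exact: measurable_funM.
have bB : bounded_mfun (fun w => Num.min 1 (B w)).
  by apply: bmin => //; exact: measurable_funM.
apply: (@le_trans _ _ (\int[P]_w (Num.min 1 (A w) + Num.min 1 (B w)))).
  apply: le_Exp => //; [|exact: bounded_mfunD|move=> w].
    apply: bmin => [|w]; last by rewrite mulr_ge0// mulr_ge0// addr_ge0.
    by apply: measurable_funM => //; apply: measurable_funM => //; exact: measurable_funD.
  apply: le_trans (min1D (A0 w) (B0 w)).
  have -> // : theta / r * ((V (X s w) + c) * growth gamma (env Y s w) 0 l) = A w + B w.
  by rewrite /A /B; ring.
rewrite (ExpD P1 bA bB).
have HA : \int[P]_w Num.min 1 (A w) <= theta / r * tail l by exact: V_growth.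
have HB : \int[P]_w Num.min 1 (B w) <= theta / r * c * tail l.
  apply: Exp_min1Z => //; first by rewrite mulr_ge0.
  apply: le_trans (d_coef_le_r_coef statY mgamma mK gamma0 K0 (leqnn _)).
  exact: growth_moment.
apply: (le_trans (lerD HA HB)).
have -> : theta / r * tail l + theta / r * c * tail l = theta * ((1 + c) / r * tail l).
  by ring.
have C0 : 0 <= (1 + c) / r by rewrite divr_ge0 ?addr_ge0// ltW.
have H1 : (1 + c) / r * tail l <= (1 + c) / r * tail i by rewrite ler_wpM2l// tail_le.
have H2 : 0 <= (1 + c) / r * tail l by rewrite mulr_ge0// tail_ge0.
apply: le_trans H1; rewrite ler_piMl//; exact: ltW.
Qed.

(** The fixed state replaces [X s] twice, in the probability of the intersection and in that of [B],
    which explains the factor 2. The covariance left is between [A] and a function of the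
    environment after a gap [q - i]; causality bounds it. *)
Lemma past_future_covariance j n i q A B :
  (0 < i)%N -> (i <= q)%N -> (q <= n)%N ->
  <<s history X Y (upto j) (upto j) >> A ->
  <<s history X Y (from (j + n%:Z)) (from (j + n%:Z)) >> B ->
  `|fine (P (A `&` B)) - fine (P A) * fine (P B)| <=
    2 * ((1 - theta / 2) ^+ ((n - (q - i)) %/ q.+1) +
      (fine (alpha_coef Y (q - i)) + ((1 + V point) / r + 2 / r) * tail i) / (theta / 2))
    + fine (alpha_coef Y (q - i)).
Proof.
move=> i0 iq qn sA sB; have [th0 th1 rr0] := And3 theta_gt0 theta_lt1 r_gt0.
set n' := (n - (q - i))%N; set N := (n' %/ q.+1)%N.
set a := fine (alpha_coef Y (q - i)).
pose s := j + (q - i)%N%:Z.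
have qin : (q - i <= n)%N by rewrite (leq_trans _ qn)// leq_subr.
have sn' : s + n'%:Z = j + n%:Z by rewrite /s -addrA -PoszD /n' subnKC.
rewrite -sn' in sB.
pose x0 : TX := point.
set E := _ ^+ N + _.
have UE : \int[P]_w uncoupled gamma K beta r theta q.+1 i (V (X s w) + V x0) (env Y s w) N <= E.
  exact: chain_uncoupled.
apply/ler_addgt0Pr => e e0; have e2 : 0 < e / 2 by rewrite divr_gt0.
have [h uh hB] := future_approx mcre sB e2.
have js : (j <= s)%R by rewrite /s lerDl.
have pA : <<s history X Y (upto s) setT >> A.
  apply: sigma_history_sub sA => //; move=> k; rewrite /upto/= => /le_trans; exact.
have pT t : <<s history X Y (upto t) setT >> setT.
  exact: (@measurableT _ (g_sigma_algebraType (history X Y (upto t) setT))).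
have mA := sigma_history_measurable sA; have mB := sigma_history_measurable sB.
have msub (J1 J2 : set int) : J1 `<=` J2 -> measurable_fun setT
    (id : g_sigma_algebraType (history X Y set0 J2) ->
          g_sigma_algebraType (history X Y set0 J1)).
  by move=> J12; exact: measurable_history_sub.
have uhT : unit_mfun (h : g_sigma_algebraType (history X Y set0 setT) * TX -> R).
  have mp : measurable_fun setT (fun p : g_sigma_algebraType (history X Y set0 setT) * TX =>
      (p.1, p.2) : g_sigma_algebraType (history X Y set0 (from (s + n'%:Z))) * TX).
    apply: measurable_fun_pair => //.
    exact: (measurableT_comp (msub (from (s + n'%:Z)) setT _) measurable_fst).
  have := unit_mfun_comp mp uh; congr unit_mfun.
  by apply/funext => -[].
have ss' : (s <= s + n'%:Z)%R by rewrite lerDl.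
pose g w := enviter Q (env Y s w) n' (fun z => h (w, z)).
have step H : <<s history X Y (upto s) setT >> H ->
    `|fine (P (B `&` H)) - \int[P]_w (\1_H w * g w (X s w))| <= e / 2.
  move=> pH; have := MCRE_iter mcre n' pH uhT; rewrite -/(g _ _) => <-.
  by apply: hB; exact: past_le ss' _ pH.
have um (x : Omega -> TX) : measurable_fun setT x -> unit_mfun (fun w => g w (x w)).
  by move=> mx; exact: (unit_mfun_chain (J := setT)).
have ugX : unit_mfun (fun w => g w (X s w)) by apply: um; exact: measurable_funPT.
have ug0 : unit_mfun (fun w => g w x0) by exact: um.
have ug0' : unit_mfun (fun w => g w x0 : R)
    (T := g_sigma_algebraType (history X Y set0 (from s))).
  pose OY := g_sigma_algebraType (history X Y set0 (from s)).
  have uh' : unit_mfun (h : OY * TX -> R).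
    have mp : measurable_fun setT (fun p : OY * TX =>
        (p.1, p.2) : g_sigma_algebraType (history X Y set0 (from (s + n'%:Z))) * TX).
      apply: measurable_fun_pair => //.
      have ft : from (s + n'%:Z) `<=` from s by move=> k; rewrite /from/=; exact: le_trans.
      exact: (measurableT_comp (msub _ _ ft) measurable_fst).
    have := unit_mfun_comp mp uh; congr unit_mfun.
    by apply/funext => -[].
  have my k : (k < n')%N -> measurable_fun setT (Y (s + k%:Z) : OY -> TY).
    by move=> _; apply: historyY; rewrite /from/= lerDl.
  exact: (unit_mfun_comp (pair2_measurable x0) (unit_mfun_enviter_joint Q my uh')).
have bgX := unit_bounded_mfun ugX; have bg0 := unit_bounded_mfun ug0.
have iL : (i < q.+1)%N by [].
have bU : bounded_mfun (fun w =>
    uncoupled gamma K beta r theta q.+1 i (V (X s w) + V x0) (env Y s w) N).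
  apply/unit_bounded_mfun.
  apply: (unit_mfun_uncoupled driftV minorV r_gt0 theta_gt0 theta_lt1 iL
    (v := fun w => V (X s w) + V x0)) => //; first exact: measurable_funD.
  by move=> w; rewrite addr_ge0.
have gU w : `|g w (X s w) - g w x0| <=
    uncoupled gamma K beta r theta q.+1 i (V (X s w) + V x0) (env Y s w) N.
  have uhw : unit_mfun (fun z => h (w, z)).
    split; first by apply: measurableT_comp uh.1 _; exact: pair1_measurable.
    by move=> z; exact: uh.2.
  (* [n'] need not be a multiple of the block length: the leftover steps come last and are absorbed
     into the test function, which remains a unit function. *)
  rewrite /g (divn_eq n' q.+1) -/N enviter_add.
  by apply: enviter_uncoupled_norm => //; exact: unit_mfun_enviter.
have compare H : measurable H ->
    `|\int[P]_w (\1_H w * g w (X s w)) - \int[P]_w (\1_H w * g w x0)| <= E.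
  move=> mH; have b1H : bounded_mfun (\1_H : Omega -> R).
    exact/unit_bounded_mfun/unit_mfun_indic.
  have bl := bounded_mfunM b1H bgX; have br := bounded_mfunM b1H bg0.
  rewrite -(ExpB P1 bl br); apply: le_trans UE.
  apply: (le_trans (le_normr_Rintegral _ (bounded_integrable P1 (bounded_mfunB bl br)))) => //.
  apply: le_Exp => //; first exact/bounded_mfun_norm/bounded_mfunB.
  move=> w; rewrite -mulrBr normrM; apply: le_trans (gU w).
  have /andP[H0 H1] := indic01 (R := R) H w.
  by rewrite ler_piMl// ger0_norm.
have H1 := step _ pA; have H2 := step _ (pT s).
have H3 := compare _ mA; have H4 := compare _ measurableT.
have H5 := covariance_functions (@history_measurable _ _ _ _ _ _ _ P X Y (upto j) (upto j))
    (@history_measurable _ _ _ _ _ _ _ P X Y set0 (from s))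
    (fun A' F => causal_covariance mcre environment_forgets)
    (unit_mfun_indic (T := g_sigma_algebraType (history X Y (upto j) (upto j))) sA) ug0'.
have noT (f : Omega -> R) : \int[P]_w (\1_[set: Omega] w * f w) = \int[P]_w f w.
  by apply: eq_Rintegral => w _; rewrite indicT mul1r.
rewrite !noT setIT in H2; rewrite !noT in H4.
rewrite Exp_indic// in H5; rewrite setIC in H1.
have /andP[A0 A1'] := Exp_unit P1 (unit_mfun_indic mA).
rewrite Exp_indic// in A0 A1'.
move: H1 H2 H3 H4 H5; rewrite -/a.
set x := \int[P]_w (\1_A w * g w (X s w)); set y := \int[P]_w (\1_A w * g w x0).
set u := \int[P]_w g w (X s w); set v := \int[P]_w g w x0.
set p := fine (P A); set b := fine (P B); set pab := fine (P (A `&` B)).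
move=> H1 H2 H3 H4 H5.
have -> : pab - p * b = (pab - x) + (x - y) + (y - p * v) + (p * (v - u) + p * (u - b)).
  by ring.
have pz z t : `|z| <= t -> `|p * z| <= t.
  by move=> zt; rewrite normrM (ger0_norm A0) (le_trans _ zt)// ler_piMl.
have H6 : `|p * (v - u)| <= E by apply: pz; rewrite distrC.
have H7 : `|p * (u - b)| <= e / 2 by apply: pz; rewrite distrC.
apply: (@le_trans _ _ (e / 2 + E + a + (E + e / 2))); last first.
  by rewrite le_eqVlt; apply/orP; left; apply/eqP; field.
by do 4 (apply: (le_trans (ler_normD _ _)); apply: lerD => //).
Qed.

End forgetting.

(** * The mixing bound *)

Section joint_history.
Context {d dX dY : measure_display} {Omega : measurableType d}
  {TX : measurableType dX} {TY : measurableType dY} {R : realType}.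
Variable P : probability Omega R.
Variables (X : int -> {RV P >-> TX}) (Y : int -> {RV P >-> TY}).

Lemma sigma_process_joint (J : set int) :
  sigma_process J (joint X Y) `<=` <<s history X Y J J >>.
Proof.
apply: smallest_sub; first exact: smallest_sigma_algebra.
move=> A [k Jk [B mB <-]].
have mp : measurable_fun setT
    ((fun w => (X k w, Y k w)) : g_sigma_algebraType (history X Y J J) -> TX * TY).
  by apply: measurable_fun_pair; [exact: historyX|exact: historyY].
exact: mp.
Qed.

End joint_history.

Section small_set_level.
Context {d dX dY : measure_display} {Omega : measurableType d}
  {TX : measurableType dX} {TY : measurableType dY} {R : realType}.
Variable P : probability Omega R.
Variable Y : int -> {RV P >-> TY}.
Variable Q : R.-pker (TY * TX)%type ~> TX.
Variables (V : TX -> R) (beta : R -> TY -> R).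
Hypotheses (statY : stationary Y) (minorV : minorization Q V beta)
  (tailb : small_set_tail beta Y).

(** (A2) controls nonnegative times; stationarity carries the level found there to all integers. *)
Lemma small_set_level (r e : R) : 0 < r -> 0 < e -> exists2 b : R, 0 < b < 1 &
  forall t : int, fine (P [set w | b < beta r (Y t w)]) <= e.
Proof.
move=> r0 e0.
pose F (b : R) := ereal_sup [set P [set w | b < beta r (Y t%:Z w)] | t in [set: nat]].
have : F b @[b --> (1 : R)^'-] --> 0%:E by exact: tailb.
move=> /fine_cvgP[Ffin] /cvgrPdist_le /(_ _ e0) Fe.
have b0 : \forall b \near (1 : R)^'-, 0 < b by exact: nbhs_left_gt.
have b1 : \forall b \near (1 : R)^'-, b < 1 by exact: nbhs_left_lt.
have [b [[[Fb Fbe] b0'] b1']] := @filter_ex _ _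
  (at_left_proper_filter (1 : R)) _ (filterI (filterI (filterI Ffin Fe) b0) b1).
exists b; first by rewrite b0' b1'.
pose A := [set x : 1.-tuple TY | b < beta r (tnth x ord0)].
have mb := measurable_beta minorV r0.
have mA : measurable A.
  apply: (strict_superlevel_measurable (f := fun x : 1.-tuple TY => beta r (tnth x ord0))).
  by apply: (measurableT_comp mb); exact: measurable_tnth.
move=> t.
have -> : P [set w | b < beta r (Y t w)] = P [set w | b < beta r (Y 0 w)].
  have := statY (fun=> 0) t mA; rewrite /pushforward.
  rewrite (_ : _ @^-1` A = [set w | b < beta r (Y t w)]); last first.
    by apply/seteqP; split => w; rewrite /A /= tnth_mktuple add0r.
  move=> ->; congr (P _).
  by apply/seteqP; split => w; rewrite /A /= tnth_mktuple.
have mS : measurable [set w | b < beta r (Y 0 w)].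
  apply: strict_superlevel_measurable.
  by apply: (measurableT_comp mb); exact: measurable_funPT.
have PF : (P [set w | (b < beta r (Y 0 w))%R] <= F b)%E.
  by apply: ereal_sup_ubound; exists 0%N.
move: Fbe; rewrite /= sub0r normrN => /(le_trans (ler_norm _)); apply: le_trans.
by apply: fine_le => //; rewrite fin_num_measure.
Qed.

End small_set_level.

(** Despite the gap and the incomplete last block, [n / q <= 2 * (N + 1)]: the 2 is responsible for
    the square root, the 1 for the factor [p^-1]. *)
Lemma geometric_blocks {R : realType} (p : R) (n i q : nat) : 0 < p -> p < 1 ->
  (0 < i)%N -> (i <= q)%N -> (q <= n)%N ->
  p ^+ ((n - (q - i)) %/ q.+1) <= p^-1 * Num.sqrt p `^ (n%:R / q%:R).
Proof.
move=> p0 p1 i0 iq qn; set N := (_ %/ _)%N.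
have q0 : (0 < q)%N by exact: leq_trans iq.
have q0R : 0 < q%:R :> R by rewrite ltr0n.
have nN : n%:R / q%:R <= 2 * (N.+1%:R) :> R.
  rewrite ler_pdivrMr// -!natrM ler_nat.
  have := ltn_ceil (n - (q - i)) (ltn0Sn q); rewrite -/N.
  move: i0 iq qn; nia.
rewrite -(powR12_sqrt (ltW p0)) -powRrM ler_pdivlMl// -exprS -(powR_mulrn _ (ltW p0)).
apply: ger_powR; first by rewrite p0 (ltW p1).
by move: nN; lra.
Qed.

Theorem theorem2p12
  (R : realType)
  (TX TY : completeMetricType R)
  (sepX : separable TX) (sepY : separable TY)
  (d : measure_display) (Omega : measurableType d) (P : probability Omega R)
  (Y : int -> {RV P >-> borel TY})
  (Q : R.-pker (borel TY * borel TX)%type ~> borel TX)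
  (V : borel TX -> R) (gamma K : borel TY -> R) (beta : R -> borel TY -> R)
  (statY : stationary Y) (mixY : alpha_mixing Y)
  (hA : assumptionA Q V gamma K beta Y)
  (Xs : int -> {RV P >-> borel TX})
  (mcreXY : MCRE Q Xs Y) (statXY : stationary (joint Xs Y)) :
  exists kappa c : R,
    [/\ 0 < kappa < 1,
        0 < c &
        forall n : nat, (1 <= n)%N ->
          (alpha_coef (joint Xs Y) n <=
           c%:E * ereal_inf [set z : \bar R | exists i q : nat,
             [/\ (1 <= i)%N, (i <= q)%N, (q <= n)%N &
                 z = r_coef gamma K Y i + (kappa `^ (n%:R / q%:R))%:E
                     + alpha_coef Y (q - i)%N]])%E].
Proof.
pose T := tail Y gamma K.
have TE i : (T i)%:E = r_coef gamma K Y i by exact: (tailE statY hA).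
have T0 i : 0 <= T i by exact: (tail_ge0 statY hA).
(* The factor 8 brings the mean cost [2 / r * T 0] of the load down to 1/4; the added 1 makes [r]
   positive. *)
pose r := 8 * T 0%N + 1.
have r0 : 0 < r by rewrite ltr_wpDl// mulr_ge0.
have rT : 8 * T 0%N <= r by rewrite lerDl.
have [b /andP[b0 b1] bP] := small_set_level statY (A_minorization hA) (A2 hA) r0
  (divr_gt0 ltr01 (ltr0n _ 4)).
pose theta := 1 - b; pose p := 1 - theta / 2.
have th0 : 0 < theta by rewrite /theta; lra.
have th1 : theta < 1 by rewrite /theta; lra.
have p0 : 0 < p by rewrite /p; lra.
have p1 : p < 1 by rewrite /p; lra.
have thP t : fine (P [set w | 1 - theta < beta r (Y t w)]) <= 1 / 4.
  by rewrite /theta subKr; exact: bP.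
pose C := (1 + V point) / r + 2 / r.
have V0 : 0 <= V point by have [[_ V0]] := A_drift hA.
have C0 : 0 <= C by rewrite /C -mulrDl divr_ge0 ?(ltW r0)// !addr_ge0.
(* The summands are the coefficients of the geometric term, of the mixing coefficient and of the
   tail in [past_future_covariance]; their sum dominates each of them. *)
pose c := 2 / p + (4 / theta + 1) + 4 * C / theta.
have c1 : 0 < 2 / p by rewrite divr_gt0.
have c2 : 0 < 4 / theta by rewrite divr_gt0.
have c3 : 0 <= 4 * C / theta by rewrite divr_ge0 ?mulr_ge0// ltW.
have c0 : 0 < c by rewrite /c; lra.
exists (Num.sqrt p), c; split => //.
  rewrite sqrtr_gt0 p0/= -sqrtr1 ltr_sqrt//.
move=> n n1.
have main j i q A B : (0 < i)%N -> (i <= q)%N -> (q <= n)%N ->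
    sigma_process (upto j) (joint Xs Y) A ->
    sigma_process (from (j + n%:Z)) (joint Xs Y) B ->
    `|fine (P (A `&` B)) - fine (P A) * fine (P B)| <=
    c * (T i + Num.sqrt p `^ (n%:R / q%:R) + fine (alpha_coef Y (q - i))).
  move=> i0 iq qn /sigma_process_joint sA /sigma_process_joint sB.
  have := past_future_covariance statY hA mcreXY statXY r0 th0 th1 rT thP mixY
    i0 iq qn sA sB.
  move=> /le_trans; apply.
  have := geometric_blocks p0 p1 i0 iq qn; rewrite -/p -/C -/(T i).
  set k := Num.sqrt p `^ _; set a := fine _; set pN := p ^+ _ => H.
  have a0 : 0 <= a by rewrite fine_ge0// alpha_coef_ge0.
  have k0 : 0 <= k by exact: powR_ge0.
  have -> : (a + C * T i) / (theta / 2) = (2 / theta) * a + (2 * C / theta) * T i.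
    by field; rewrite gt_eqF.
  have H1 : 2 * pN <= 2 / p * k by rewrite -mulrA ler_pM2l.
  have Ti := T0 i.
  have E1 : 0 <= (4 / theta + 1 + 4 * C / theta) * k by rewrite mulr_ge0//; lra.
  have E2 : 0 <= (2 / p + (4 / theta + 1)) * T i by rewrite mulr_ge0//; lra.
  have E3 : 0 <= (2 / p + 4 * C / theta) * a by rewrite mulr_ge0//; lra.
  rewrite /c; lra.
(* Dividing by [c] leaves a lower bound of the infimum to be proved, hence one estimate for each
   pair [i], [q]. *)
rewrite -lee_pdivrMl//; apply: le_ereal_inf_tmp => _ [i [q [i0 iq qn ->]]].
rewrite lee_pdivrMl// -TE -(alpha_coef_fineK Y) -!EFinD -EFinM.
apply: ge_ereal_sup => _ [j _ <-]; apply: ge_ereal_sup => _ [A sA [B sB <-]].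
have mA := sigma_history_measurable (sigma_process_joint sA).
have mB := sigma_history_measurable (sigma_process_joint sB).
by rewrite covariance_fine// lee_fin; exact: main sA sB.
Qed.
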